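(* For every $n$, the space $\mathcal{D}(n)$ of Delzant polytopes in $\mathbb{R}^n$, with its CW topology, is weakly contractible (that is, all its homotopy groups are trivial).
   Context: $\mathcal{D}(n)$ is the set of Delzant polytopes in $\mathbb{R}^n$: full-dimensional polytopes such that every vertex lies in exactly $n$ edges, all edge directions are rational, and at each vertex the primitive integer edge vectors form a basis of $\mathbb{Z}^n$. Let $\mathcal{P}(n)$ be the set of all (not necessarily full-dimensional) polytopes in $\mathbb{R}^n$. CW topology. The normal fan $\mathcal{N}(P)$ of a polytope consists of the cones $\{\alpha\in(\mathbb{R}^n)^*:\langle\alpha,p-q\rangle\ge0\ \forall p\in F,q\in P\}$ for the nonempty faces $F$ of $P$; a complete fan $\Sigma'$ refines $\Sigma$ if every cone of $\Sigma'$ is contained in a cone of $\Sigma$. For a polytopal fan $\mathcal{N}$ (the normal fan of some polytope), the set $\mathcal{P}(\mathcal{N})$ of polytopes $P$ such that $\mathcal{N}$ refines $\mathcal{N}(P)$ is identified, via the support function $h_P(\alpha)=\max_{x\in P}\langle\alpha,x\rangle$, with a closed polyhedral cone in the finite-dimensional space of functions that are linear on each cone of $\mathcal{N}$. Let $\widetilde{\mathcal{P}(n)}$ be the quotient of $\mathcal{P}(n)\setminus\{\text{points}\}$ by translations and positive scalings, and let $\bar e_{\mathcal{N}}$ (for $\mathcal{N}\ne\{(\mathbb{R}^n)^*\}$) be the image of $\mathcal{P}(\mathcal{N})\setminus\{\text{points}\}$, with the quotient topology. These are the closed cells of a regular CW complex structure on $\widetilde{\mathcal{P}(n)}$, in whose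 topology a set is closed iff its intersection with each $\bar e_{\mathcal{N}}$ is closed. The map $P\mapsto(\widetilde P,\mathrm{c}(P),\mathrm{r}(P))$, where $\widetilde P$ is the class of $P$ and $\mathrm{c}(P),\mathrm{r}(P)$ are the center and radius of the smallest ball enclosing $P$, is a bijection $\mathcal{P}(n)\setminus\{\text{points}\}\to\widetilde{\mathcal{P}(n)}\times\mathbb{R}^n\times(0,\infty)$; the CW topology on $\mathcal{P}(n)\setminus\{\text{points}\}$ is the product topology transported through this bijection, and $\mathcal{D}(n)$ carries the subspace topology. *)

(* Defs.v *)
From HB Require Import structures.
From mathcomp Require Import all_boot all_order all_algebra.
From mathcomp Require Import all_classical all_reals all_analysis.

Set Implicit Arguments.
Unset Strict Implicit.
Unset Printing Implicit Defensive.

Import Order.TTheory GRing.Theory Num.Theory.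
Import numFieldNormedType.Exports.

Local Open Scope classical_set_scope.
Local Open Scope ring_scope.
Local Open Scope quotient_scope.

(* Points of R^n are row vectors, elements of the dual space are column
   vectors. *)

Section Polytopes.
Context {R : realType} {n : nat}.
Implicit Types (P F E A : set 'rV[R]_n) (N : set (set 'cV[R]_n)).

Definition pairing (a : 'cV[R]_n) (x : 'rV[R]_n) : R := (x *m a) 0 0.

Definition conv_hull (k : nat) (v : 'I_k -> 'rV[R]_n) : set 'rV[R]_n :=
  [set \sum_i t i *: v i |
    t in [set t : 'I_k -> R | (forall i, 0 <= t i) /\ \sum_i t i = 1]].

Definition is_polytope P : Prop :=
  exists (k : nat) (v : 'I_k.+1 -> 'rV[R]_n), P = conv_hull v.

(* The dimension of the affine hull of [A]: [U] is the linear span of the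
   differences of points of [A]. *)
Definition has_dim A (d : nat) : Prop :=
  A !=set0 /\
  exists U : {vspace 'rV[R]_n},
    [/\ \dim U = d,
        forall x y, A x -> A y -> x - y \in U &
        forall W : {vspace 'rV[R]_n},
          (forall x y, A x -> A y -> x - y \in W) -> (U <= W)%VS].

(* The empty face is not excluded here, and [P] is a face of itself. *)
Definition is_face P F : Prop :=
  exists (a : 'cV[R]_n) (c : R),
    (forall x, P x -> pairing a x <= c) /\ F = P `&` [set x | pairing a x = c].

Definition is_vertex P (v : 'rV[R]_n) : Prop := is_face P [set v].

Definition is_edge P E : Prop := is_face P E /\ has_dim E 1.

Definition edges_at P (v : 'rV[R]_n) : set (set 'rV[R]_n) :=
  [set E | is_edge P E /\ E v].

Definition intvec (u : 'rV[int]_n) : 'rV[R]_n := map_mx intr u.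

Definition rational_direction E : Prop :=
  exists u : 'rV[int]_n,
    forall x y, E x -> E y -> exists t : R, y - x = t *: intvec u.

Definition primitive_vec (u : 'rV[int]_n) : Prop :=
  \big[gcdz/0]_(i < n) u 0 i = 1.

Definition primitive_edge_vectors P (v : 'rV[R]_n) : set 'rV[int]_n :=
  [set u | primitive_vec u /\
    exists2 E, edges_at P v E & exists2 t : R, 0 < t & E (v + t *: intvec u)].

Definition is_Zbasis (B : 'M[int]_n) : Prop :=
  forall w : 'rV[int]_n, exists! c : 'rV[int]_n, c *m B = w.

Definition is_delzant P : Prop :=
  [/\ is_polytope P,
      has_dim P n,
      forall v, is_vertex P v -> (edges_at P v #= `I_n)%card,
      forall E, is_edge P E -> rational_direction E &
      forall v, is_vertex P v ->
        exists2 B : 'M[int]_n,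
          range (fun i => row i B) = primitive_edge_vectors P v & is_Zbasis B].

Definition normal_cone P F : set 'cV[R]_n :=
  [set a | forall p q, F p -> P q -> 0 <= pairing a (p - q)].

Definition normal_fan P : set (set 'cV[R]_n) :=
  [set normal_cone P F | F in [set F | is_face P F /\ F !=set0]].

Definition refines N' N : Prop :=
  forall C', N' C' -> exists2 C, N C & C' `<=` C.

Definition polytopal N : Prop := exists2 P, is_polytope P & N = normal_fan P.

Definition support_fun P (a : 'cV[R]_n) : R := sup [set pairing a x | x in P].

Definition is_point P : Prop := exists x, P = [set x].

Definition homothetic P Q : Prop :=
  exists (t : R) (v : 'rV[R]_n), 0 < t /\ Q = [set t *: x + v | x in P].

Definition enorm (x : 'rV[R]_n) : R := Num.sqrt (\sum_i x 0 i ^+ 2).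

Definition ball_encloses P (b : 'rV[R]_n * R) : Prop :=
  forall x, P x -> enorm (x - b.1) <= b.2.

(* A smallest ball enclosing a polytope exists and is unique, so the default
   value [(0, 0)] is never used for polytopes. *)
Definition min_ball P : 'rV[R]_n * R :=
  xget (0, 0) [set b | ball_encloses P b /\
                       forall b', ball_encloses P b' -> b.2 <= b'.2].

Definition ball_center P : 'rV[R]_n := (min_ball P).1.
Definition ball_radius P : R := (min_ball P).2.

End Polytopes.

Section Types.
Variables (R : realType) (n : nat).

Record polytope := Polytope {
  polytope_set :> set 'rV[R]_n;
  polytopeP : is_polytope polytope_set }.

HB.instance Definition _ := gen_eqMixin polytope.
HB.instance Definition _ := gen_choiceMixin polytope.

(* P(n) minus the points *)
Record npolytope := NPolytope {
  npolytope_val :> polytope;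
  npolytopeP : ~ is_point npolytope_val }.

HB.instance Definition _ := gen_eqMixin npolytope.
HB.instance Definition _ := gen_choiceMixin npolytope.

Record delzant := Delzant {
  delzant_set :> set 'rV[R]_n;
  delzantP : is_delzant delzant_set }.

HB.instance Definition _ := gen_eqMixin delzant.
HB.instance Definition _ := gen_choiceMixin delzant.

End Types.

Section CWTopology.
Variables (R : realType) (n : nat).
Implicit Types N : set (set 'cV[R]_n).

Definition homotheticb (P Q : npolytope R n) : bool := `[< homothetic P Q >].

Lemma homotheticb_refl : reflexive homotheticb.
Proof.
move=> P; apply/asboolP; exists 1, 0; split => //.
apply/seteqP; split => [x Px|x [y Py <-]]; last by rewrite scale1r addr0.
by exists x => //; rewrite scale1r addr0.
Qed.

Lemma homothetic_sym (P Q : set 'rV[R]_n) : homothetic P Q -> homothetic Q P.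
Proof.
move=> [t [v [t0 ->]]]; exists t^-1, (- (t^-1 *: v)); rewrite invr_gt0.
have E x : t^-1 *: (t *: x + v) + - (t^-1 *: v) = x.
  by rewrite scalerDr addrK scalerA mulVf ?gt_eqF// scale1r.
split => //; apply/seteqP; split => [x Px|x [_ [y Py <-] <-]]; last by rewrite E.
by exists (t *: x + v) => //; exists x.
Qed.

Lemma homotheticb_sym : symmetric homotheticb.
Proof.
by move=> P Q; apply/asboolP/asboolP => /homothetic_sym.
Qed.

Lemma homotheticb_trans : transitive homotheticb.
Proof.
move=> Q P S /asboolP [t [v [t0 QE]]] /asboolP [s [w [s0 SE]]].
apply/asboolP; exists (s * t), (s *: v + w); split; first exact: mulr_gt0.
rewrite SE QE image_comp; apply: eq_imagel => x _ /=.
by rewrite scalerDr scalerA addrA.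
Qed.

Definition homothety_rel : equiv_rel (npolytope R n) :=
  EquivRel homotheticb homotheticb_refl homotheticb_sym homotheticb_trans.

Definition polyshape : Type := {eq_quot homothety_rel}.

HB.instance Definition _ := Choice.on polyshape.

Definition shape_of (P : npolytope R n) : polyshape := \pi_({eq_quot homothety_rel}) P.

(* P(N) minus the points *)
Definition fan_polytopes N : set (npolytope R n) :=
  [set P | refines N (normal_fan P)].

Definition fan_support N (P : fan_polytopes N) : {ptws 'cV[R]_n -> R} :=
  support_fun (set_val P).

(* Support functions of elements of P(N) lie in the finite-dimensional space of
   functions that are linear on each cone of N. On a finite-dimensional space
   of functions the pointwise topology is the (unique Hausdorff) vector space
   topology. *)
Definition fan_space N : topologicalType :=
  initial_topology (@fan_support N).

Definition fan_shape N (P : fan_space N) : polyshape := shape_of (set_val P).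

Definition cell N : set polyshape := range (@fan_shape N).

(* A subset of a cell that is closed in the quotient topology induced by
   [fan_shape N] from P(N) minus the points *)
Definition cell_closed N (A : set polyshape) : Prop :=
  A `<=` cell N /\ closed (@fan_shape N @^-1` A).

Definition cw_closed (A : set polyshape) : Prop :=
  forall N, polytopal N -> N <> [set setT] -> cell_closed N (A `&` cell N).

Definition cw_open (A : set polyshape) : Prop := cw_closed (~` A).

Lemma cw_openE A : cw_open A <->
  (forall N, polytopal N -> N <> [set setT] -> open (@fan_shape N @^-1` A)).
Proof.
have E N : @fan_shape N @^-1` (~` A `&` cell N) = ~` (@fan_shape N @^-1` A).
  by apply/seteqP; split => [P []//|P AP]; split => //; exists P.
split=> H N pN NT.
  by have [_] := H N pN NT; rewrite E closedC.
split; first by move=> ? [].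
by rewrite E closedC; exact: H.
Qed.

Lemma cw_openT : cw_open setT.
Proof. by apply/cw_openE => N _ _; rewrite preimage_setT; exact: openT. Qed.

Lemma cw_openI : setI_closed cw_open.
Proof.
move=> A B /cw_openE Ao /cw_openE Bo; apply/cw_openE => N pN NT.
by rewrite preimage_setI; apply: openI; [exact: Ao|exact: Bo].
Qed.

Lemma cw_open_bigcup (I : Type) (f : I -> set polyshape) :
  (forall i, cw_open (f i)) -> cw_open (\bigcup_i f i).
Proof.
move=> fo; apply/cw_openE => N pN NT.
rewrite preimage_bigcup; apply: bigcup_open => i _.
by have /cw_openE := fo i; apply.
Qed.

HB.instance Definition _ :=
  isOpenTopological.Build polyshape cw_openT cw_openI cw_open_bigcup.

Definition cw_chart (P : npolytope R n) : polyshape * ('rV[R]_n * R) :=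
  (shape_of P, (ball_center P, ball_radius P)).

(* The radii lie in (0, +oo), so the topology transported through the bijection
   with polyshape * R^n * (0, +oo) is the initial topology of [cw_chart]. *)
Definition npolytope_space : topologicalType := initial_topology cw_chart.

(* For 0 < n a Delzant polytope is not a point, and this is the subspace
   topology. For n = 0 the only Delzant polytope is the point R^0, and this is
   the topology of the one-point space. *)
Definition delzant_open (U : set (delzant R n)) : Prop :=
  exists2 W : set npolytope_space, open W &
    forall (D : delzant R n) (P : npolytope R n),
      (D : set 'rV[R]_n) = P -> (U D <-> W P).

Lemma delzant_openT : delzant_open setT.
Proof. by exists setT => //; exact: openT. Qed.

Lemma delzant_openI : setI_closed delzant_open.
Proof.
move=> A B [V Vo VE] [W Wo WE]; exists (V `&` W); first exact: openI.
move=> D P DP; have [v1 v2] := VE _ _ DP; have [w1 w2] := WE _ _ DP.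
by split => -[a b]; split; auto.
Qed.

Lemma delzant_open_bigcup (I : Type) (f : I -> set (delzant R n)) :
  (forall i, delzant_open (f i)) -> delzant_open (\bigcup_i f i).
Proof.
move=> fo.
have /choice[W HW] : forall i, exists W : set npolytope_space, open W /\
    forall (D : delzant R n) (P : npolytope R n),
      (D : set 'rV[R]_n) = P -> (f i D <-> W P).
  by move=> i; have [W ? ?] := fo i; exists W.
exists (\bigcup_i W i); first by apply: bigcup_open => i _; exact: (HW i).1.
move=> D P DP; split => -[i _ h]; exists i => //.
  by apply/((HW i).2 D P DP).
by apply/((HW i).2 D P DP).
Qed.

HB.instance Definition _ := isOpenTopological.Build (delzant R n)
  delzant_openT delzant_openI delzant_open_bigcup.

End CWTopology.

Section WeakContractibility.
Variables (R : realType) (X : topologicalType).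

Definition cube {k : nat} : set 'rV[R]_k :=
  [set s | forall i, 0 <= s 0 i <= 1].

Definition cube_boundary {k : nat} : set 'rV[R]_k :=
  cube `&` [set s | exists i, s 0 i = 0 \/ s 0 i = 1].

Definition sphere_map (k : nat) (x0 : X) (f : 'rV[R]_k -> X) : Prop :=
  {within cube, continuous f} /\ (forall s, cube_boundary s -> f s = x0).

Definition sphere_homotopic (k : nat) (x0 : X) (f g : 'rV[R]_k -> X) : Prop :=
  exists H : R * 'rV[R]_k -> X,
    [/\ {within `[0, 1] `*` cube, continuous H},
        forall s, cube s -> H (0, s) = f s,
        forall s, cube s -> H (1, s) = g s &
        forall t s, 0 <= t <= 1 -> cube_boundary s -> H (t, s) = x0].

(* pi_k(X, x0), the set of classes of maps (I^k, boundary) -> (X, x0) modulo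
   homotopy relative to the boundary, has a single element. For k = 0 the
   boundary is empty and this says that X is path connected. *)
Definition trivial_pi (k : nat) (x0 : X) : Prop :=
  forall f g : 'rV[R]_k -> X,
    sphere_map x0 f -> sphere_map x0 g -> sphere_homotopic x0 f g.

Definition weakly_contractible : Prop :=
  [set: X] !=set0 /\ forall (k : nat) (x0 : X), trivial_pi k x0.

End WeakContractibility.

(* Main.v *)
From Pilot Require Import Defs.
From HB Require Import structures.
From mathcomp Require Import all_boot all_order all_algebra.
From mathcomp Require Import all_classical all_reals all_analysis.
From mathcomp Require Import ring lra.
(* so that [ball_center] denotes the center of the smallest enclosing ball *)
Import Pilot.Defs.

(** Two maps [f] and [g] from a cube to the space of Delzant polytopes, equal to
    a constant [P0] on the boundary, are joined by the homotopy
    [(1 - t) f s + t g s + lam (t, s) Q] of Minkowski sums, for a suitable fixed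
    Delzant polytope [Q] and a function [lam] that is positive inside the prism
    and vanishes on its boundary.  Where [lam] vanishes the sum is [f s], [g s] or
    [P0].  Where [lam] is positive the sum is Delzant as soon as the normal fan of
    [Q] refines those of [f s] and [g s], for it then has the same normal fan as
    [Q] ([blend_delzant]).

    The same [Q] serves for all [s].  The image of the cube is compact, hence
    meets finitely many open cells of the CW complex ([finite_normal_fans]), so
    only finitely many rational fans have to be refined.  Let [u] range over the
    edge directions of one polytope for each of these fans.  If no hyperplane
    orthogonal to a [u] cuts a cone of the normal fan of [Q], then that fan is a
    refinement of all of them ([delzant_compatible]).  Such a [Q] is obtained from
    the cube by cutting off faces of codimension two, which on the dual side
    subdivides the cone of two rays [a] and [b] by [a + b] and preserves
    smoothness ([blow_up]).  Choosing rays at which the values of [u] have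
    opposite signs and are as far apart as possible, the procedure terminates
    ([model_refinable]).  Two facts of polyhedral geometry enter, both deduced
    from Gordan's alternative: a polytope is determined by its support function,
    and it lies in the cone spanned by the edges at any of its vertices
    ([edges_generate]).

    For the continuity of the homotopy, the support functions depend continuously
    on the polytope for the CW topology ([support_fun_cvg]), they are additive for
    Minkowski sums, and inside the closed cell of the normal fan of [Q] their
    pointwise convergence implies convergence for the CW topology
    ([npolytope_cvg]).  Both facts rest on the continuity of the center and the
    radius of the smallest enclosing ball ([ball_center_cvg],
    [ball_radius_cvg]). *)

Set Implicit Arguments.
Unset Strict Implicit.
Unset Printing Implicit Defensive.

Import Order.TTheory GRing.Theory Num.Theory.
Import numFieldNormedType.Exports.

Local Open Scope classical_set_scope.
Local Open Scope ring_scope.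

(** * Linear functionals, separation and support functions *)

Section Pairing.
Context {R : realType} {n : nat}.
Implicit Types (a b : 'cV[R]_n) (x y : 'rV[R]_n).

Lemma pairingDl a b x : pairing (a + b) x = pairing a x + pairing b x.
Proof. by rewrite /pairing mulmxDr mxE. Qed.

Lemma pairingDr a x y : pairing a (x + y) = pairing a x + pairing a y.
Proof. by rewrite /pairing mulmxDl mxE. Qed.

Lemma pairingNl a x : pairing (- a) x = - pairing a x.
Proof. by rewrite /pairing mulmxN mxE. Qed.

Lemma pairingNr a x : pairing a (- x) = - pairing a x.
Proof. by rewrite /pairing mulNmx mxE. Qed.

Lemma pairingBl a b x : pairing (a - b) x = pairing a x - pairing b x.
Proof. by rewrite pairingDl pairingNl. Qed.

Lemma pairingBr a x y : pairing a (x - y) = pairing a x - pairing a y.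
Proof. by rewrite pairingDr pairingNr. Qed.

Lemma pairingZl (t : R) a x : pairing (t *: a) x = t * pairing a x.
Proof. by rewrite /pairing -scalemxAr mxE. Qed.

Lemma pairingZr (t : R) a x : pairing a (t *: x) = t * pairing a x.
Proof. by rewrite /pairing -scalemxAl mxE. Qed.

Lemma pairing0l x : pairing (0 : 'cV[R]_n) x = 0.
Proof. by rewrite /pairing mulmx0 mxE. Qed.

Lemma pairing0r a : pairing a 0 = 0.
Proof. by rewrite /pairing mul0mx mxE. Qed.

Lemma pairing_suml (I : Type) (r : seq I) (P : pred I) (F : I -> 'cV[R]_n) x :
  pairing (\sum_(i <- r | P i) F i) x = \sum_(i <- r | P i) pairing (F i) x.
Proof. by rewrite /pairing mulmx_sumr summxE. Qed.

Lemma pairing_sumr (I : Type) (r : seq I) (P : pred I) (F : I -> 'rV[R]_n) a :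
  pairing a (\sum_(i <- r | P i) F i) = \sum_(i <- r | P i) pairing a (F i).
Proof. by rewrite /pairing mulmx_suml summxE. Qed.

Lemma pairingE a x : pairing a x = \sum_i x 0 i * a i 0.
Proof. by rewrite /pairing mxE. Qed.

Lemma pairing_tr_ge0 x : 0 <= pairing x^T x.
Proof. by rewrite pairingE sumr_ge0// => i _; rewrite mxE -expr2 sqr_ge0. Qed.

Lemma pairing_tr_eq0 x : (pairing x^T x == 0) = (x == 0).
Proof.
apply/idP/eqP => [|->]; last by rewrite pairing0r.
rewrite pairingE psumr_eq0 => [/allP x0|i _]; last by rewrite mxE -expr2 sqr_ge0.
apply/rowP => i; have /implyP/(_ isT) := x0 i (mem_index_enum i).
by rewrite !mxE -expr2 sqrf_eq0 => /eqP.
Qed.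

End Pairing.

Section FiniteFamilies.
Context {R : realType}.

Lemma finite_lower_bound (I : finType) (c : I -> R) :
  (forall i, 0 < c i) -> exists2 e, 0 < e & forall i, e <= c i.
Proof.
move=> c0; exists (\big[Num.min/1]_i c i).
  by elim/big_ind: _ => // x y x0 y0; rewrite lt_min x0 y0.
by move=> i; rewrite (bigD1 i)//= ge_min lexx.
Qed.

Lemma small_perturbation (I : finType) (x y : I -> R) :
  (forall i, x i < 0) -> exists2 e, 0 < e & forall i, x i + e * y i < 0.
Proof.
move=> x0.
have [i|e e0 eP] := @finite_lower_bound I (fun i => - x i / (1 + `|y i|)).
  by rewrite divr_gt0// ?oppr_gt0// ltr_pwDl.
exists e => // i; have := eP i; rewrite ler_pdivlMr ?ltr_pwDl// => h.
have := ler_wpM2l (ltW e0) (ler_norm (y i)); lra.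
Qed.

End FiniteFamilies.

Section Separation.
Context {R : realType} {n : nat}.
Implicit Types (a : 'cV[R]_n) (x : 'rV[R]_n) (P : set 'rV[R]_n).

(** Gordan's alternative, by induction on the number of vectors.  A functional
    [a] negative on all vectors but [w0], where it is positive, shows that
    projecting the others along [w0] to the kernel of [a] only adds nonnegative
    multiples of [w0]; the alternative for the projections then lifts. *)
Lemma gordan_ord m (w : 'I_m -> 'rV[R]_n) :
  (exists t : 'I_m -> R, [/\ forall i, 0 <= t i, exists i, 0 < t i &
                             \sum_i t i *: w i = 0]) \/
  (exists a, forall i, pairing a (w i) < 0).
Proof.
elim: m w => [w|m IH w]; first by right; exists 0 => -[].
pose w0 := w ord0; pose w' j := w (lift ord0 j).
pose ext (t0 : R) (t : 'I_m -> R) i := if unlift ord0 i is Some j then t j else t0.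
have ext_ge0 t0 t : 0 <= t0 -> (forall j, 0 <= t j) -> forall i, 0 <= ext t0 t i.
  by move=> ? ? i; rewrite /ext; case: unliftP.
have ext_lift t0 t j : ext t0 t (lift ord0 j) = t j by rewrite /ext liftK.
have ext0 t0 t : ext t0 t ord0 = t0 by rewrite /ext unlift_none.
have ext_sum t0 t : \sum_i ext t0 t i *: w i = t0 *: w0 + \sum_j t j *: w' j.
  rewrite big_ord_recl ext0; congr (_ + _).
  by apply: eq_bigr => j _; rewrite ext_lift.
have [[t [t0 [i ti] tw]]|[a aw]] := IH w'.
  left; exists (ext 0 t); split; [exact: ext_ge0| |].
    by exists (lift ord0 i); rewrite ext_lift.
  by rewrite ext_sum scale0r add0r.
have extw (c : 'cV[R]_n) : pairing c w0 < 0 -> (forall j, pairing c (w' j) < 0) ->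
    exists a, forall i, pairing a (w i) < 0.
  by move=> c0 cj; exists c => i; case: (unliftP ord0 i) => [j ->|->]; [exact: cj|].
have [aw0|aw0|aw0] := ltgtP (pairing a w0) 0; first by right; exact: (extw a).
- pose y j := w' j - (pairing a (w' j) / pairing a w0) *: w0.
  have [[t [t0 [i ti] ty]]|[b bw]] := IH y.
    left; pose s := \sum_j t j * (- pairing a (w' j) / pairing a w0).
    exists (ext s t); split.
    + apply: ext_ge0 => //; apply: sumr_ge0 => j _.
      by rewrite mulr_ge0// divr_ge0// ?oppr_ge0 ltW.
    + by exists (lift ord0 i); rewrite ext_lift.
    + rewrite ext_sum -[RHS]ty /s scaler_suml -big_split; apply: eq_bigr => j _ /=.
      by rewrite /y scalerBr mulNr mulrN scaleNr scalerA addrC.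
  have [e e0 eP] := @small_perturbation R _ (fun j => pairing b (y j))
                      (fun j => - pairing a (w' j)) bw.
  right; apply: (extw (b - (pairing b w0 / pairing a w0 + e) *: a)).
    rewrite pairingBl pairingZl mulrDl divfK ?gt_eqF// opprD addNKr.
    by rewrite oppr_lt0 mulr_gt0.
  move=> j; have := eP j; rewrite /y pairingBr pairingZr pairingBl pairingZl.
  congr (_ < _); field; exact: lt0r_neq0.
- have [w00|w00] := eqVneq w0 0.
    left; exists (ext 1 (fun=> 0)); split; [exact: ext_ge0| |].
      by exists ord0; rewrite ext0.
    rewrite ext_sum w00 scaler0 add0r big1// => j _; exact: scale0r.
  have [e e0 eP] := @small_perturbation R _ (fun j => pairing a (w' j))
                      (fun j => - pairing w0^T (w' j)) aw.
  right; apply: (extw (a - e *: w0^T)).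
    rewrite pairingBl pairingZl aw0 sub0r oppr_lt0 mulr_gt0//.
    by rewrite lt_neqAle eq_sym pairing_tr_eq0 w00 pairing_tr_ge0.
  by move=> j; have := eP j; rewrite pairingBl pairingZl mulrN.
Qed.

Lemma gordan (I : finType) (w : I -> 'rV[R]_n) :
  (exists t : I -> R, [/\ forall i, 0 <= t i, exists i, 0 < t i &
                          \sum_i t i *: w i = 0]) \/
  (exists a, forall i, pairing a (w i) < 0).
Proof.
have [[t [t0 [i ti] tw]]|[a aw]] := gordan_ord (fun j : 'I_#|I| => w (enum_val j)).
  left; exists (fun i => t (enum_rank i)); split => //.
    by exists (enum_val i); rewrite enum_valK.
  rewrite -[RHS]tw [LHS](reindex (fun j : 'I_#|I| => enum_val j)); last first.
    exact: (onW_bij _ (@enum_val_bij I)).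
  by apply: eq_bigr => j _; rewrite enum_valK.
by right; exists a => i; have := aw (enum_rank i); rewrite enum_rankK.
Qed.

Lemma conv_hull_gen k (v : 'I_k -> 'rV[R]_n) i : conv_hull v (v i).
Proof.
exists (fun j => (j == i)%:R); first split.
- by move=> j; rewrite ler0n.
- by rewrite (bigD1 i)//= eqxx big1 ?addr0// => j /negPf ->.
- rewrite (bigD1 i)//= eqxx scale1r big1 ?addr0// => j /negPf ->.
  by rewrite scale0r.
Qed.

Lemma pairing_conv_hull_le k (v : 'I_k -> 'rV[R]_n) a c x :
  (forall i, pairing a (v i) <= c) -> conv_hull v x -> pairing a x <= c.
Proof.
move=> vc [t [t0 t1] <-]; rewrite pairing_sumr -[c]mul1r -t1 mulr_suml.
by apply: ler_sum => i _; rewrite pairingZr ler_wpM2l.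
Qed.

(** Gordan's alternative for the vectors [v i - x]: a vanishing nonnegative
    combination of them, once normalized, exhibits [x] as a point of the hull. *)
Lemma conv_hull_separation k (v : 'I_k -> 'rV[R]_n) x : ~ conv_hull v x ->
  exists a, forall i, pairing a (v i) < pairing a x.
Proof.
move=> vx; have [[t [t0 [i ti] tw]]|[a aw]] := gordan (fun i => v i - x); last first.
  by exists a => i; rewrite -subr_lt0 -pairingBr.
exfalso; apply: vx; set s := \sum_i t i.
have s0 : 0 < s.
  rewrite /s (bigD1 i)//= ltr_pwDl//; exact: sumr_ge0.
exists (fun i => t i / s); first split.
- by move=> j; rewrite divr_ge0// ltW.
- by rewrite -mulr_suml divff// gt_eqF.
- move/eqP: tw; under eq_bigr do rewrite scalerBr.
  rewrite sumrB subr_eq0 -scaler_suml => /eqP tw.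
  under eq_bigr do rewrite mulrC -scalerA.
  by rewrite -scaler_sumr tw scalerA mulVf ?scale1r ?gt_eqF.
Qed.

Definition convex_set P :=
  forall x y (t : R), P x -> P y -> 0 <= t <= 1 -> P (t *: x + (1 - t) *: y).

Lemma convex_set_conv_hull k (v : 'I_k -> 'rV[R]_n) : convex_set (conv_hull v).
Proof.
move=> _ _ t [p [p0 p1] <-] [q [q0 q1] <-] /andP[t0 t1].
exists (fun i => t * p i + (1 - t) * q i); first split.
- by move=> i; rewrite addr_ge0// mulr_ge0// subr_ge0.
- by rewrite big_split/= -!mulr_sumr p1 q1; ring.
- rewrite !scaler_sumr -big_split; apply: eq_bigr => i _.
  by rewrite /= scalerDl !scalerA.
Qed.

Lemma conv_hull_sub k (v : 'I_k -> 'rV[R]_n) P :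
  convex_set P -> (forall i, P (v i)) -> conv_hull v `<=` P.
Proof.
move=> cP; elim: k v => [v Pv x [t [t0 t1] tx]|k IH v Pv x [t [t0 t1] <-]].
  by move/eqP: t1; rewrite big_ord0 eq_sym oner_eq0.
rewrite big_ord_recl; have [t01|t01] := eqVneq (t ord0) 1.
  move/eqP: t1; rewrite big_ord_recl t01 eq_sym addrC -subr_eq subrr eq_sym.
  rewrite psumr_eq0// => /allP h.
  rewrite big1 ?addr0 ?scale1r// => j _.
  by have /implyP/(_ isT)/eqP -> := h j (mem_index_enum j); rewrite scale0r.
have t0le : t ord0 <= 1.
  by rewrite -t1 big_ord_recl lerDl; exact: sumr_ge0.
have s0 : 0 < 1 - t ord0 by rewrite subr_gt0 lt_neqAle t01.
rewrite -(scale1r (\sum_(i < k) _)) -(divff (lt0r_neq0 s0)) -scalerA.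
apply: cP => //; last by rewrite t0 t0le.
apply: (IH (fun j => v (lift ord0 j))) => //.
exists (fun j => t (lift ord0 j) / (1 - t ord0)); first split.
- by move=> j; rewrite divr_ge0// ltW.
- have E : \sum_(j < k) t (lift ord0 j) = 1 - t ord0.
    by rewrite -t1 big_ord_recl addrAC subrr add0r.
  by rewrite -mulr_suml E divff// lt0r_neq0.
- by rewrite scaler_sumr; apply: eq_bigr => j _; rewrite scalerA mulrC.
Qed.

Lemma polytope_convex P : is_polytope P -> convex_set P.
Proof. by move=> [k [v ->]]; exact: convex_set_conv_hull. Qed.

Lemma polytope_max P a : is_polytope P ->
  exists2 p, P p & forall x, P x -> pairing a x <= pairing a p.
Proof.
move=> [k [v ->]]; pose i0 := [arg max_(i > ord0) pairing a (v i)]%O.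
exists (v i0); first exact: conv_hull_gen.
move=> x; apply: pairing_conv_hull_le => i.
by rewrite /i0; case: arg_maxP => // j _; apply.
Qed.

Lemma polytope_nonempty P : is_polytope P -> P !=set0.
Proof. by move=> /(polytope_max 0) [p Pp _]; exists p. Qed.

(** A point of [P] outside the convex hull of the [w i] would be separated from
    it by a functional whose maximum over [P] no [w i] attains. *)
Lemma polytope_of_maximizers (I : finType) (w : I -> 'rV[R]_n) P :
  convex_set P -> (forall i, P (w i)) ->
  (forall a, exists i, forall x, P x -> pairing a x <= pairing a (w i)) ->
  is_polytope P.
Proof.
move=> cP Pw wmax; have [i0 _] := wmax 0.
have E : #|I|.-1.+1 = #|I| by rewrite prednK//; apply/card_gt0P; exists i0.
pose v (j : 'I_(#|I|.-1.+1)) := w (enum_val (cast_ord E j)).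
exists #|I|.-1, v; apply/seteqP; split=> [x Px|]; last first.
  by apply: conv_hull_sub => // j; exact: Pw.
apply: contrapT => /conv_hull_separation[a ax].
have [i iP] := wmax a; have := ax (cast_ord (esym E) (enum_rank i)).
by rewrite /v cast_ordKV enum_rankK ltNge iP.
Qed.

Lemma support_funE P a p : P p -> (forall x, P x -> pairing a x <= pairing a p) ->
  support_fun P a = pairing a p.
Proof.
move=> Pp pmax; apply/eqP; rewrite eq_le; apply/andP; split.
  by apply: ge_sup; [exists (pairing a p), p|move=> _ [x Px <-]; exact: pmax].
apply: ub_le_sup; last by exists p.
by exists (pairing a p) => _ [x Px <-]; exact: pmax.
Qed.

Lemma support_fun_max P a : is_polytope P ->
  exists p, [/\ P p, support_fun P a = pairing a p &
                forall x, P x -> pairing a x <= pairing a p].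
Proof. by move=> /(polytope_max a)[p Pp pm]; exists p; rewrite (support_funE Pp). Qed.

Lemma pairing_le_support P a x : is_polytope P -> P x ->
  pairing a x <= support_fun P a.
Proof. by move=> /(support_fun_max a)[p [_ -> pm]]; exact: pm. Qed.

Lemma support_fun_subset P Q : is_polytope P -> is_polytope Q ->
  (forall a, support_fun P a <= support_fun Q a) -> P `<=` Q.
Proof.
move=> pP [k [v Qv]] PQ x Px; apply: contrapT; rewrite Qv.
move=> /conv_hull_separation[a ax].
have pQ : is_polytope Q by exists k, v.
have [q [Qq qE _]] := support_fun_max a pQ.
have := le_trans (pairing_le_support a pP Px) (PQ a).
rewrite qE leNgt => /negP; apply.
have ij : conv_hull v q by rewrite -Qv.
have [j jv] : exists j, forall i, pairing a (v i) <= pairing a (v j).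
  exists [arg max_(i > ord0) pairing a (v i)]%O => i.
  by case: arg_maxP => // j _; apply.
exact: le_lt_trans (pairing_conv_hull_le jv ij) (ax j).
Qed.

Lemma support_fun_inj P Q : is_polytope P -> is_polytope Q ->
  support_fun P =1 support_fun Q -> P = Q.
Proof.
by move=> pP pQ E; apply/seteqP; split; apply: support_fun_subset => // a; rewrite E.
Qed.

End Separation.

(** * Unimodular cones and smooth polytopes *)

Section IntegerVectors.
Context {R : realType} {n : nat}.
Implicit Types (u v : 'rV[int]_n) (a : 'cV[int]_n) (B : 'M[int]_n).

Definition intcovec a : 'cV[R]_n := map_mx intr a.

Definition ipairing a u : int := (u *m a) 0 0.

Lemma pairing_int a u : pairing (intcovec a) (intvec u : 'rV[R]_n) = (ipairing a u)%:~R.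
Proof. by rewrite /pairing /intcovec /intvec -map_mxM mxE. Qed.

Lemma intcovecD a a' : intcovec (a + a') = intcovec a + intcovec a'.
Proof. exact: map_mxD. Qed.

Lemma ipairingDl a a' u : ipairing (a + a') u = ipairing a u + ipairing a' u.
Proof. by rewrite /ipairing mulmxDr mxE. Qed.

(** The rows of [B] are the edge directions of a unimodular cone, and the
    dual basis consists of the columns of the inverse of [B], which are the
    inner normals of its facets. *)
Definition edge_dir B i : 'rV[R]_n := intvec (row i B).

Definition facet_normal B (i : 'I_n) : 'cV[int]_n := col i (invmx B).

Lemma ipairing_dual B i j : B \in unitmx ->
  ipairing (facet_normal B i) (row j B) = (i == j)%:R.
Proof.
move=> uB; have := mulmxV uB => /matrixP/(_ j i); rewrite !mxE eq_sym => <-.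
by rewrite /ipairing /facet_normal mxE; apply: eq_bigr => k _; rewrite !mxE.
Qed.

Lemma pairing_dual B i j : B \in unitmx ->
  pairing (intcovec (facet_normal B i)) (edge_dir B j) = (i == j)%:R.
Proof. by move=> uB; rewrite pairing_int ipairing_dual//; case: (i == j). Qed.

Lemma covec_decomposition B a : B \in unitmx ->
  a = \sum_i ipairing a (row i B) *: facet_normal B i.
Proof.
move=> uB; rewrite -[LHS]mul1mx -(mulVmx uB) -mulmxA.
apply/colP => k; rewrite mxE summxE; apply: eq_bigr => i _.
rewrite !mxE mulrC /ipairing !mxE; congr (_ * _).
by apply: eq_bigr => l _; rewrite !mxE.
Qed.

Lemma edge_decomposition B (x : 'rV[R]_n) : B \in unitmx ->
  x = \sum_i pairing (intcovec (facet_normal B i)) x *: edge_dir B i.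
Proof.
move=> uB.
have E : map_mx intr (invmx B) *m map_mx intr B = 1%:M :> 'M[R]_n.
  by rewrite -map_mxM mulVmx// map_mx1.
rewrite -[LHS]mulmx1 -E mulmxA.
apply/rowP => k; rewrite mxE summxE; apply: eq_bigr => i _.
rewrite /pairing /edge_dir /intvec /facet_normal !mxE; congr (_ * _).
by apply: eq_bigr => l _; rewrite !mxE.
Qed.

Definition in_cone B (x : 'rV[R]_n) :=
  forall i, 0 <= pairing (intcovec (facet_normal B i)) x.

Lemma in_cone_pairing_le0 B (a : 'cV[R]_n) x : B \in unitmx -> in_cone B x ->
  (forall i, pairing a (edge_dir B i) <= 0) -> pairing a x <= 0.
Proof.
move=> uB xB aB; rewrite (edge_decomposition x uB) pairing_sumr sumr_le0// => i _.
by rewrite pairingZr mulr_ge0_le0.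
Qed.

Lemma is_ZbasisP B : is_Zbasis B <-> B \in unitmx.
Proof.
split=> [Bb|uB w]; last first.
  exists (w *m invmx B); split; first by rewrite mulmxKV.
  by move=> c <-; rewrite mulmxK.
have /choice[c cP] : forall i, exists c : 'rV[int]_n, c *m B = delta_mx 0 i.
  by move=> i; have [c [cB _]] := Bb (delta_mx 0 i); exists c.
suff /mulmx1_unit[] : (\matrix_i c i) *m B = 1%:M by [].
by apply/row_matrixP => i; rewrite row_mul rowK cP row1.
Qed.

(** The iterated gcd is handled through its universal property, since [gcdz]
    with neutral element [0] is not a monoid law: [gcdz x 0] is [`|x|]. *)
Lemma dvdz_biggcd u (d : int) :
  (forall i, (d %| u 0%R i)%Z) -> (d %| \big[gcdz/0%R]_i u 0%R i)%Z.
Proof.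
move=> du; elim/big_ind: _ => [|x y dx dy|i _]; [exact: dvdz0| |exact: du].
by rewrite dvdz_gcd dx.
Qed.

Lemma biggcd_dvdz u i : ((\big[gcdz/0]_j u 0%R j) %| u 0%R i)%Z.
Proof.
have : i \in index_enum 'I_n by rewrite mem_index_enum.
elim: (index_enum 'I_n) => // j s IH; rewrite inE big_cons => /orP[/eqP ->|/IH].
  exact: dvdz_gcdl.
exact/dvdz_trans/dvdz_gcdr.
Qed.

Lemma biggcd_ge0 u : (0 : int) <= \big[gcdz/0]_i u 0 i.
Proof. by case: (index_enum 'I_n) => [|i s]; rewrite ?big_nil ?big_cons. Qed.

Lemma primitive_dvdz u (d : int) : primitive_vec u -> 0 <= d ->
  (forall i, (d %| u 0%R i)%Z) -> d = 1.
Proof.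
move=> pu d0 /dvdz_biggcd; rewrite pu; case: d d0 => // d _.
by rewrite dvdzE/= dvdn1 => /eqP ->.
Qed.

Lemma primitive_row B i : B \in unitmx -> primitive_vec (row i B).
Proof.
move=> uB; rewrite /primitive_vec; set d := \big[_/_]_(_ < _) _.
suff : (d %| ipairing (facet_normal B i) (row i B))%Z.
  rewrite ipairing_dual// eqxx; have : 0 <= d by exact: biggcd_ge0.
  by case: d => // d _; rewrite dvdzE/= dvdn1 => /eqP ->.
rewrite /ipairing mxE; apply: rpred_sum => j _; apply: dvdz_mulr.
exact: biggcd_dvdz.
Qed.

Lemma primitive_neq0 u : primitive_vec u -> u != 0.
Proof.
move=> pu; apply/eqP => u0; suff : 0 = 1 :> int by [].
by apply: (primitive_dvdz pu) => // i; rewrite u0 mxE dvdz0.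
Qed.

Lemma intvec_inj : injective (@intvec R n).
Proof. by move=> u v /rowP uv; apply/rowP => i; have := uv i; rewrite !mxE => /intr_inj. Qed.

Lemma intvec_eq0 u : (intvec u == 0 :> 'rV[R]_n) = (u == 0).
Proof. by rewrite -(inj_eq intvec_inj) /intvec map_mx0. Qed.

Lemma intvecZ (d : int) u : intvec (d *: u) = d%:~R *: intvec u :> 'rV[R]_n.
Proof. by apply/rowP => i; rewrite !mxE intrM. Qed.

Lemma primitive_part u : u != 0 ->
  exists (d : int) u', [/\ 0 < d, primitive_vec u' & u = d *: u'].
Proof.
move=> u0; pose d := \big[gcdz/0]_i u 0 i.
have d0 : 0 < d.
  rewrite lt_neqAle biggcd_ge0 andbT eq_sym; apply: contra u0 => /eqP d0.
  by apply/eqP/rowP => i; have := biggcd_dvdz u i; rewrite -/d d0 dvd0z mxE => /eqP.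
exists d, (\row_i (u 0%R i %/ d)%Z).
have uE : u = d *: \row_i (u 0%R i %/ d)%Z.
  by apply/rowP => i; rewrite !mxE mulrC divzK//; exact: biggcd_dvdz.
split=> //; rewrite /primitive_vec; set e := \big[_/_]_(_ < _) _.
have e0 : 0 <= e by exact: biggcd_ge0.
have : (d * e %| d)%Z.
  rewrite {2}/d; apply: dvdz_biggcd => i.
  have -> : u 0 i = d * (\row_j (u 0%R j %/ d)%Z) 0 i
    by have := uE => /rowP/(_ i) {1}->; rewrite [LHS]mxE.
  by rewrite dvdz_mul2l ?gt_eqF//; exact: biggcd_dvdz.
rewrite -[X in (_ %| X)%Z -> _]mulr1 dvdz_mul2l ?gt_eqF//=.
by case: (e) e0 => // m _; rewrite dvdzE/= dvdn1 => /eqP ->.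
Qed.

End IntegerVectors.

Section SmoothVertices.
Context {R : realType} {n : nat}.
Implicit Types (P E : set 'rV[R]_n) (w : 'rV[R]_n) (B : 'M[int]_n).

(** Near [w] the set [P] coincides with a unimodular cone with apex [w]. *)
Record smooth_vertex P w B : Prop := SmoothVertex {
  smooth_mem : P w;
  smooth_unit : B \in unitmx;
  smooth_cone : forall x, P x -> in_cone B (x - w);
  smooth_tangent : exists2 d : R, 0 < d & forall i, P (w + d *: edge_dir B i) }.

(** At a smooth vertex, the edge in the direction [edge_dir B i]: the points
    whose other coordinates with respect to the edge directions vanish. *)
Definition vertex_edge P w B (i : 'I_n) : set 'rV[R]_n :=
  P `&` [set x | forall j, j != i -> pairing (intcovec (facet_normal B j)) (x - w) = 0].

Lemma edge_dir_neq0 B i : B \in unitmx -> edge_dir B i != 0 :> 'rV[R]_n.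
Proof. by move=> uB; rewrite intvec_eq0 primitive_neq0//; exact: primitive_row. Qed.

Lemma vertex_edgeE P w B i x : B \in unitmx -> vertex_edge P w B i x ->
  x - w = pairing (intcovec (facet_normal B i)) (x - w) *: edge_dir B i.
Proof.
move=> uB [_ xi]; rewrite {1}(edge_decomposition (x - w) uB) (bigD1 i)//= big1 ?addr0//.
by move=> j /xi ->; rewrite scale0r.
Qed.

Lemma vertex_edge_point P w B i (d : R) : B \in unitmx ->
  P (w + d *: edge_dir B i) -> vertex_edge P w B i (w + d *: edge_dir B i).
Proof.
move=> uB Pd; split=> // j ji.
by rewrite addrAC subrr add0r pairingZr pairing_dual// (negPf ji) mulr0.
Qed.

Lemma tangent_functional_le0 P w B (a : 'cV[R]_n) : smooth_vertex P w B ->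
  (forall x, P x -> pairing a x <= pairing a w) ->
  forall i, pairing a (edge_dir B i) <= 0.
Proof.
move=> [_ _ _ [d d0 Pd]] aP i.
by have := aP _ (Pd i); rewrite pairingDr pairingZr gerDl pmulr_rle0.
Qed.

Lemma vertex_edge_is_edge P w B i : smooth_vertex P w B ->
  is_edge P (vertex_edge P w B i).
Proof.
move=> [Pw uB cB [d d0 Pd]]; split.
  exists (- \sum_(j | j != i) intcovec (facet_normal B j)).
  exists (pairing (- \sum_(j | j != i) intcovec (facet_normal B j)) w).
  have E x : pairing (- \sum_(j | j != i) intcovec (facet_normal B j)) w -
    pairing (- \sum_(j | j != i) intcovec (facet_normal B j)) x =
    \sum_(j | j != i) pairing (intcovec (facet_normal B j)) (x - w).
    by rewrite -pairingBr -opprB pairingNr pairingNl opprK pairing_suml.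
  split=> [x Px|].
    by rewrite -subr_ge0 E; apply: sumr_ge0 => j _; exact: cB.
  apply/seteqP; split=> x [Px xi]; split => //=.
    by apply/esym/eqP; rewrite -subr_eq0 E big1.
  move/esym/eqP: xi; rewrite -subr_eq0 E psumr_eq0 => [/allP h j ji|j _]; last exact: cB.
  by have /implyP/(_ ji)/eqP := h j (mem_index_enum j).
split; first by exists (w + d *: edge_dir B i); exact: vertex_edge_point.
exists <[edge_dir B i]>%VS; split.
- by rewrite dim_vline edge_dir_neq0.
- move=> x y /(vertex_edgeE uB) xw /(vertex_edgeE uB) yw.
  by rewrite -(subrKA w) -(opprB y) xw yw; apply: rpredB; rewrite memvZ// memv_line.
- move=> W WE.
  have : w + d *: edge_dir B i - w \in W.
    apply: WE; first exact: vertex_edge_point.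
    by split=> // j _; rewrite subrr pairing0r.
  by rewrite addrAC subrr add0r -memvE rpredZeq gt_eqF.
Qed.

(** A functional exposing a face through [w] is nonpositive on the edge
    directions at [w], and the face consists of the points of [P] in the span
    of the directions where it vanishes.  If the face has dimension one, there
    is exactly one such direction. *)
Lemma edge_is_vertex_edge P w B E : smooth_vertex P w B -> is_edge P E -> E w ->
  exists i, E = vertex_edge P w B i.
Proof.
move=> sP [[a [c [aP EE]]] [_ [U [dU UE Umin]]]] Ew.
have [Pw uB cB [d d0 Pd]] := sP.
have aw : pairing a w = c by move: Ew; rewrite EE => -[].
have a_le0 := tangent_functional_le0 sP (fun x Px => eq_ind_r (fun c => pairing a x <= c) (aP x Px) aw).
have Ed i : pairing a (edge_dir B i) = 0 -> E (w + d *: edge_dir B i).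
  by move=> ai; rewrite EE; split=> //=; rewrite pairingDr pairingZr ai mulr0 addr0.
have E0 x i : E x -> pairing a (edge_dir B i) != 0 ->
    pairing (intcovec (facet_normal B i)) (x - w) = 0.
  rewrite EE => -[Px ax] ai.
  have : pairing a (w - x) = 0 by rewrite pairingBr aw ax subrr.
  rewrite -opprB pairingNr {1}(edge_decomposition (x - w) uB) pairing_sumr => /eqP.
  rewrite -sumrN psumr_eq0 => [/allP h|j _]; last first.
    by rewrite pairingZr oppr_ge0 mulr_ge0_le0//; exact: cB.
  have /implyP/(_ isT) := h i (mem_index_enum i).
  by rewrite oppr_eq0 pairingZr mulf_eq0 (negPf ai) orbF => /eqP.
have dirU i : pairing a (edge_dir B i) = 0 -> edge_dir B i \in U.
  move=> /Ed Ei; have := UE _ _ Ei Ew.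
  by rewrite addrAC subrr add0r rpredZeq gt_eqF.
have [i ai] : exists i, pairing a (edge_dir B i) = 0.
  apply: contrapT => /forallNP aN.
  have Ew1 x : E x -> x = w.
    move=> Ex; apply/eqP; rewrite -subr_eq0 (edge_decomposition (x - w) uB) big1//.
    by move=> i _; rewrite E0 ?scale0r//; apply/eqP/aN.
  have /dimvS : (U <= 0)%VS.
    by apply: Umin => x y /Ew1 -> /Ew1 ->; rewrite subrr mem0v.
  by rewrite dU dimv0.
have aj j : j != i -> pairing a (edge_dir B j) != 0.
  move=> ji; apply/negP => /eqP aj.
  have UE1 : U = <[edge_dir B i]>%VS.
    apply/esym/eqP; rewrite eqEdim dim_vline edge_dir_neq0// dU leqnn andbT.
    by rewrite -memvE dirU.
  have := dirU j aj; rewrite UE1 => /vlineP[s jE].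
  have := pairing_dual (R := R) j j uB.
  rewrite jE pairingZr pairing_dual// (negPf ji) mulr0 eqxx => /esym/eqP.
  by rewrite oner_eq0.
exists i; apply/seteqP; split=> [x Ex|x Ex].
  split; first by move: Ex; rewrite EE => -[].
  by move=> j /aj; exact: E0.
have xw := vertex_edgeE uB Ex.
rewrite EE; split; first by case: Ex.
by rewrite /= -aw; apply/eqP; rewrite -subr_eq0 -pairingBr xw pairingZr ai mulr0.
Qed.

Lemma edges_at_smooth_vertex P w B : smooth_vertex P w B ->
  edges_at P w = range (vertex_edge P w B).
Proof.
move=> sP; apply/seteqP; split=> [E [eE Ew]|_ [i _ <-]].
  by have [i ->] := edge_is_vertex_edge sP eE Ew; exists i.
split; first exact: vertex_edge_is_edge.
split; first by case: sP.
by move=> j _; rewrite subrr pairing0r.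
Qed.

Lemma vertex_edge_inj P w B : smooth_vertex P w B -> injective (vertex_edge P w B).
Proof.
move=> [Pw uB cB [d d0 Pd]] i j ij.
have [_ wj] : vertex_edge P w B j (w + d *: edge_dir B i).
  by rewrite -ij; exact: vertex_edge_point.
apply/eqP; apply: contraT => /wj /eqP.
by rewrite addrAC subrr add0r pairingZr pairing_dual// eqxx mulr1 gt_eqF.
Qed.

(** A primitive vector on the ray of [row i B] is a nonnegative integer multiple
    of it, the integer being a dual coordinate, and divisibility forces the
    multiple to be one. *)
Lemma primitive_edge_smooth_vertex P w B : smooth_vertex P w B ->
  primitive_edge_vectors P w = range (fun i => row i B).
Proof.
move=> sP; have [Pw uB cB [d d0 Pd]] := sP.
apply/seteqP; split=> [u [pu [E eE [t t0 Et]]]|_ [i _ <-]]; last first.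
  split; first exact: primitive_row.
  exists (vertex_edge P w B i); first by rewrite (edges_at_smooth_vertex sP); exists i.
  by exists d => //; exact: vertex_edge_point.
move: eE; rewrite (edges_at_smooth_vertex sP) => -[i _ iE]; exists i => //.
rewrite -{}iE in Et.
have /eqP := vertex_edgeE uB Et; rewrite addrAC subrr add0r pairingZr pairing_int.
rewrite -scalerA -intvecZ (inj_eq (scalerI (lt0r_neq0 t0))) => /eqP/intvec_inj uE.
have m0 : 0 <= ipairing (facet_normal B i) u.
  have [/cB/(_ i) + _] := Et.
  by rewrite addrAC subrr add0r pairingZr pmulr_rge0// pairing_int ler0z.
rewrite uE (primitive_dvdz pu m0) ?scale1r// => j.
by have := uE => /rowP/(_ j) ->; rewrite mxE dvdz_mulr.
Qed.

Lemma card_edges_at_smooth_vertex P w B : smooth_vertex P w B ->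
  (edges_at P w #= `I_n)%card.
Proof.
move=> sP; rewrite (edges_at_smooth_vertex sP).
apply: (card_eq_trans (inj_card_eq _)); first exact: in2W (vertex_edge_inj sP).
rewrite card_eq_sym; have -> : `I_n = range (@nat_of_ord n).
  by apply/seteqP; split=> [k kn|_ [i _ <-]] /=; [exists (Ordinal kn)|exact: ltn_ord].
exact: inj_card_eq (in2W val_inj).
Qed.

End SmoothVertices.

Section SmoothModels.
Context {R : realType} {n : nat}.

(** The vertices [w k] of the smooth polytope [Q], with possible repetitions,
    together with the unimodular cones of [Q] at these vertices.  In the last
    field the cones of functionals maximal at the [w k] cover the dual space,
    so that no vertex is missing. *)
Record smooth_model (K : finType) (Q : set 'rV[R]_n) (w : K -> 'rV[R]_n)
    (B : K -> 'M[int]_n) : Prop := SmoothModel {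
  model_convex : convex_set Q;
  model_vertex : forall k, smooth_vertex Q (w k) (B k);
  model_complete : forall a : 'cV[R]_n,
    exists k, forall i, pairing a (edge_dir (B k) i) <= 0 }.

Lemma model_max K Q w B : @smooth_model K Q w B -> forall a k,
  (forall i, pairing a (edge_dir (B k) i) <= 0) ->
  forall x, Q x -> pairing a x <= pairing a (w k).
Proof.
move=> [_ sQ _] a k ak x Qx; rewrite -subr_le0 -pairingBr.
by have [_ uB cB _] := sQ k; apply: in_cone_pairing_le0 (cB _ Qx) _.
Qed.

Lemma model_polytope K Q w B : @smooth_model K Q w B -> is_polytope Q.
Proof.
move=> mQ; have [cQ sQ aQ] := mQ; apply: (@polytope_of_maximizers _ _ K w) => //.
  by move=> k; case: (sQ k).
by move=> a; have [k ak] := aQ a; exists k; exact: model_max ak.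
Qed.

Lemma model_face_vertex K Q w B F : @smooth_model K Q w B ->
  is_face Q F -> F !=set0 -> exists k, F (w k).
Proof.
move=> mQ [a [c [aQ ->]]] [x [Qx ax]]; have [k ak] := model_complete mQ a.
exists k; split; first by case: (model_vertex mQ k).
apply/eqP; rewrite eq_le /= aQ; last by case: (model_vertex mQ k).
by rewrite -[c]ax (model_max mQ ak).
Qed.

Lemma model_full_dim K Q w B : @smooth_model K Q w B -> has_dim Q n.
Proof.
move=> mQ; have [k _] := model_complete mQ 0.
have [Qw uB _ [d d0 Qd]] := model_vertex mQ k.
split; first by exists (w k).
exists fullv; split=> [|x y _ _|W WQ]; [by rewrite dimvf /dim/= mul1n|exact: memvf|].
apply/subvP => x _; rewrite (edge_decomposition x uB); apply: rpred_sum => i _.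
apply: rpredZ; have := WQ _ _ (Qd i) Qw.
by rewrite addrAC subrr add0r rpredZeq gt_eqF.
Qed.

Lemma model_delzant K Q w B : @smooth_model K Q w B -> is_delzant Q.
Proof.
move=> mQ; have sQ := model_vertex mQ.
have vk v : is_vertex Q v -> exists k, v = w k.
  by move=> vQ; have [|k wv] := model_face_vertex mQ vQ; [exists v|exists k].
split.
- exact: model_polytope mQ.
- exact: model_full_dim mQ.
- by move=> v /vk[k ->]; exact: card_edges_at_smooth_vertex.
- move=> E eE; have [fE [E0 _]] := eE.
  have [k Ew] := model_face_vertex mQ fE E0.
  have [i ->] := edge_is_vertex_edge (sQ k) eE Ew.
  exists (row i (B k)) => x y xE yE; have uB := smooth_unit (sQ k).
  rewrite -(subrKA (w k)) -(opprB x) (vertex_edgeE uB xE) (vertex_edgeE uB yE).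
  by rewrite -scalerBl; eexists.
- move=> v /vk[k ->]; exists (B k); last exact/is_ZbasisP/smooth_unit.
  by rewrite (primitive_edge_smooth_vertex (sQ k)).
Qed.

End SmoothModels.

(** * Cutting off faces of codimension two *)

Section BlowUp.
Context {R : realType} {n : nat}.
Implicit Types (P : set 'rV[R]_n) (w : 'rV[R]_n) (B : 'M[int]_n) (p q : 'I_n).

Definition is_ray B (a : 'cV[int]_n) := exists i, facet_normal B i = a.

(** Replaces the edge direction [b_q] by [b_q - b_p]; dually, it replaces the
    facet normal [a_p] by [a_p + a_q]. *)
Definition shear p q B : 'M[int]_n := (1%:M - delta_mx q p) *m B.

Lemma shear_inverse p q B : p != q -> B \in unitmx ->
  shear p q B *m (invmx B *m (1%:M + delta_mx q p)) = 1%:M.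
Proof.
move=> pq uB; rewrite /shear mulmxA mulmxK// mulmxDr mulmx1 mulmxBl mul1mx.
by rewrite mul_delta_mx_0// subr0 subrK.
Qed.

Lemma shear_unit p q B : p != q -> B \in unitmx -> shear p q B \in unitmx.
Proof. by move=> pq uB; case: (mulmx1_unit (shear_inverse pq uB)). Qed.

Lemma row_shear p q B i :
  row i (shear p q B) = if i == q then row q B - row p B else row i B.
Proof.
have -> : shear p q B = B - delta_mx q p *m B by rewrite /shear mulmxBl mul1mx.
apply/rowP => j; rewrite !mxE (bigD1 p)//= mxE eqxx andbT big1 => [|l lp].
  by case: eqP => [->|_]; rewrite !mxE ?mul1r ?mul0r ?addr0 ?subr0.
by rewrite mxE (negPf lp) andbF mul0r.
Qed.

Lemma facet_normal_shear p q B i : p != q -> B \in unitmx ->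
  facet_normal (shear p q B) i =
    if i == p then facet_normal B p + facet_normal B q else facet_normal B i.
Proof.
move=> pq uB; have us := shear_unit pq uB; rewrite /facet_normal.
have -> : invmx (shear p q B) = invmx B *m (1%:M + delta_mx q p).
  by apply: (can_inj (mulKmx us)); rewrite mulmxV// shear_inverse.
rewrite mulmxDr mulmx1; apply/colP => j; rewrite !mxE (bigD1 q)//= mxE eqxx /=.
rewrite big1 => [|l lq]; last by rewrite mxE (negPf lq) mulr0.
by case: eqP => [->|_]; rewrite !mxE ?mulr1 ?mulr0 ?addr0.
Qed.

Lemma edge_dir_shear p q B i : edge_dir (shear p q B) i =
  if i == q then edge_dir B q - edge_dir B p else edge_dir B i :> 'rV[R]_n.
Proof. by rewrite /edge_dir row_shear; case: eqP => // _; rewrite /intvec map_mxB. Qed.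

Lemma facet_normal_inj B : B \in unitmx -> injective (facet_normal B).
Proof.
move=> uB i j ij; have := ipairing_dual i j uB; rewrite ij ipairing_dual// eqxx.
by case: eqP.
Qed.

Lemma ray_shear p q B a : p != q -> B \in unitmx -> is_ray (shear p q B) a ->
  (is_ray B a /\ a <> facet_normal B p) \/ a = facet_normal B p + facet_normal B q.
Proof.
move=> pq uB [i <-]; rewrite facet_normal_shear//; have [_|ip] := eqVneq i p.
  by right.
left; split; first by exists i.
by move=> /(facet_normal_inj uB) /eqP; rewrite (negPf ip).
Qed.

Lemma convex_halfspace P (a : 'cV[R]_n) c : convex_set P ->
  convex_set (P `&` [set x | c <= pairing a x]).
Proof.
move=> cP x y t [Px ax] [Py ay] /andP[t0 t1]; split; first by apply: cP; rewrite ?t0.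
have hx : 0 <= t * (pairing a x - c) by rewrite mulr_ge0// subr_ge0.
have hy : 0 <= (1 - t) * (pairing a y - c) by rewrite mulr_ge0// subr_ge0.
rewrite /= pairingDr !pairingZr; lra.
Qed.

Lemma convex_step P x v (d e : R) : convex_set P -> 0 <= e <= d -> 0 < d ->
  P x -> P (x + d *: v) -> P (x + e *: v).
Proof.
move=> cP /andP[e0 ed] d0 Px Pd.
have -> : x + e *: v = (e / d) *: (x + d *: v) + (1 - e / d) *: x.
  by apply/rowP => j; rewrite !mxE; field; exact: lt0r_neq0.
by apply: cP => //; rewrite divr_ge0 ?(ltW d0)//= ler_pdivrMr ?mul1r.
Qed.

Lemma smooth_vertex_cut P w B (a : 'cV[R]_n) m e : convex_set P ->
  smooth_vertex P w B -> 0 < e -> (forall x, P x -> m <= pairing a x) ->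
  m + e *+ 2 <= pairing a w ->
  smooth_vertex (P `&` [set x | m + e <= pairing a x]) w B.
Proof.
move=> cP [Pw uB cB [d d0 Pd]] e0 am aw; split=> //.
- by split=> //=; lra.
- by move=> x [/cB].
- exists (d / 2) => [|i]; first by lra.
  split; first by apply: (convex_step (d := d)) => //; lra.
  have := am _ (Pd i); rewrite /= !pairingDr !pairingZr; lra.
Qed.

(** The vertex [w] lies on the codimension two face where the facets with
    normals [p] and [q] meet.  Cutting this face off at height [e] moves [w]
    along the edge leaving either of the two facets; the new edge direction
    [b_q - b_p] joins the two resulting vertices. *)
Lemma smooth_vertex_shear P w B p q e : convex_set P -> smooth_vertex P w B ->
  p != q -> 0 < e -> (forall i, P (w + (e *+ 2) *: edge_dir B i)) ->
  let a := intcovec (facet_normal B p + facet_normal B q) in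
  smooth_vertex (P `&` [set x | pairing a w + e <= pairing a x])
    (w + e *: edge_dir B p) (shear p q B).
Proof.
move=> cP [Pw uB cB _] pq e0 Pe /=; set a := intcovec _.
have aE x : pairing a x = pairing (intcovec (facet_normal B p)) x +
                          pairing (intcovec (facet_normal B q)) x.
  by rewrite /a intcovecD pairingDl.
have ai i : pairing a (edge_dir B i) = ((i == p) || (i == q))%:R.
  rewrite aE !pairing_dual// ![_ == i]eq_sym.
  by case: eqVneq => [->|_]; rewrite ?(negPf pq) ?addr0 ?add0r.
have Pe1 i : P (w + e *: edge_dir B i).
  by apply: (convex_step (d := e *+ 2)) => //; lra.
split.
- by split; [exact: Pe1|rewrite /= pairingDr pairingZr ai eqxx mulr1].
- exact: shear_unit.
- move=> x [Px /= ax] i; rewrite facet_normal_shear// opprD addrA.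
  have xw := cB _ Px; case: eqVneq => [_|ip]; last first.
    by rewrite pairingBr pairingZr pairing_dual// (negPf ip) mulr0 subr0; exact: xw.
  by rewrite -/a pairingBr pairingZr ai eqxx mulr1 pairingBr; lra.
- exists e => // i; rewrite edge_dir_shear; have [_|iq] := eqVneq i q.
    have -> : w + e *: edge_dir B p + e *: (edge_dir B q - edge_dir B p) =
      w + e *: edge_dir B q by apply/rowP => j; rewrite !mxE; ring.
    by split; [exact: Pe1|rewrite /= pairingDr pairingZr ai eqxx orbT mulr1].
  split; last first.
    by rewrite /= !pairingDr !pairingZr !ai eqxx mulr1 lerDl mulr_ge0 ?ler0n ?ltW.
  have -> : w + e *: edge_dir B p + e *: edge_dir B i =
     2^-1 *: (w + (e *+ 2) *: edge_dir B p) +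
     (1 - 2^-1) *: (w + (e *+ 2) *: edge_dir B i).
    by apply/rowP => j; rewrite !mxE; lra.
  by apply: cP => //; lra.
Qed.

(** The normal [nu] of a facet at [w0] that contains [w] is a nonnegative integer
    combination of the facet normals at [w].  Each of those that occurs is
    constant on the facet, which spans a hyperplane, so it is proportional to
    [nu]; by integrality it is equal to [nu]. *)
Lemma facet_normal_at_vertex P w0 B0 w B i :
  smooth_vertex P w0 B0 -> smooth_vertex P w B ->
  pairing (intcovec (facet_normal B0 i)) w = pairing (intcovec (facet_normal B0 i)) w0 ->
  is_ray B (facet_normal B0 i).
Proof.
move=> [Pw0 uB0 cB0 [d0 d0_gt0 Pd0]] [Pw uB cB [d d_gt0 Pd]]; set nu := facet_normal B0 i.
move=> nuw; pose c m := ipairing nu (row m B).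
have c0 m : 0 <= c m.
  have := cB0 _ (Pd m) i; rewrite addrAC pairingDr pairingBr nuw subrr add0r.
  by rewrite pairingZr pmulr_rge0// pairing_int ler0z.
have [m cm] : exists m, c m != 0.
  apply: contrapT => /forallNP cN; have := ipairing_dual i i uB0.
  rewrite eqxx -/nu (covec_decomposition nu uB) big1 => [|m _].
    by rewrite /ipairing mulmx0 mxE => /eqP; rewrite eq_sym oner_eq0.
  by move/negP/negPn/eqP: (cN m); rewrite /c => ->; rewrite scale0r.
have face x : P x -> pairing (intcovec nu) (x - w) = 0 ->
    pairing (intcovec (facet_normal B m)) (x - w) = 0.
  move=> Px; rewrite {1}(edge_decomposition (x - w) uB) pairing_sumr => /eqP.
  rewrite psumr_eq0 => [/allP h|j _]; last first.
    rewrite pairingZr; apply: mulr_ge0; first exact: cB.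
    by rewrite pairing_int ler0z; exact: c0.
  have /implyP/(_ isT) := h m (mem_index_enum m).
  by rewrite pairingZr pairing_int mulf_eq0 intr_eq0 (negPf cm) orbF => /eqP.
have w0w : pairing (intcovec (facet_normal B m)) (w0 - w) = 0.
  by apply: face => //; rewrite pairingBr nuw subrr.
have dirj j : j != i -> ipairing (facet_normal B m) (row j B0) = 0.
  move=> ji; apply: (@intr_inj R); rewrite -pairing_int.
  have := face _ (Pd0 j); rewrite addrAC !(pairingDr _ (w0 - w)) w0w pairingBr nuw subrr.
  rewrite !add0r !pairingZr pairing_dual// eq_sym (negPf ji) mulr0 => /(_ erefl) /eqP.
  by rewrite mulf_eq0 gt_eqF//= => /eqP.
pose s := ipairing (facet_normal B m) (row i B0).
have mE : facet_normal B m = s *: nu.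
  rewrite [LHS](covec_decomposition _ uB0) (bigD1 i)//= big1 ?addr0// => j ji.
  by rewrite dirj// scale0r.
exists m; rewrite mE; suff -> : s = 1 by rewrite scale1r.
have sc : s * c m = 1.
  have := ipairing_dual m m uB; rewrite eqxx mE /c /ipairing.
  by rewrite -scalemxAr mxE.
have cm0 : 0 < c m by rewrite lt_neqAle eq_sym cm c0.
have s0 : 0 < s by rewrite -(pmulr_lgt0 _ cm0) sc.
by apply/eqP; rewrite eq_le -{1}sc ler_peMr ?gtz0_ge1// ltW.
Qed.

(** The star subdivision of the cone spanned by two rays [a] and [b] of the
    normal fan, realized by cutting off the face of codimension two where the
    facets with normals [a] and [b] meet.  Each vertex [w k] of that face is
    replaced by two vertices, indexed by a boolean; the other vertices are
    listed twice. *)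
Lemma blow_up (K : finType) (Q : set 'rV[R]_n) (w : K -> 'rV[R]_n)
    (B : K -> 'M[int]_n) (k0 : K) (i0 j0 : 'I_n) :
  smooth_model Q w B -> i0 != j0 ->
  let a := facet_normal (B k0) i0 in let b := facet_normal (B k0) j0 in
  exists (K' : finType) (Q' : set 'rV[R]_n) (w' : K' -> 'rV[R]_n)
    (B' : K' -> 'M[int]_n), [/\ smooth_model Q' w' B',
    forall k', exists k, forall c, is_ray (B' k') c ->
      is_ray (B k) c \/ [/\ c = a + b, is_ray (B k) a & is_ray (B k) b] &
    forall k', ~ (is_ray (B' k') a /\ is_ray (B' k') b)].
Proof.
move=> mQ ij a b; have [cQ sQ aQ] := mQ.
have uB k := smooth_unit (sQ k).
have ab : a <> b by move/(facet_normal_inj (uB k0))/eqP; rewrite (negPf ij).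
pose F k := `[< is_ray (B k) a /\ is_ray (B k) b >].
have /choice[pq pqP] : forall k, exists pq : 'I_n * 'I_n, F k ->
    [/\ facet_normal (B k) pq.1 = a, facet_normal (B k) pq.2 = b & pq.1 != pq.2].
  move=> k; case: (boolP (F k)) => [/asboolP[[p pa] [q qb]]|_]; last by exists (i0, j0).
  exists (p, q) => _; split=> //=; apply/eqP => pq'.
  by apply: ab; rewrite -pa -qb pq'.
pose g : 'cV[R]_n := intcovec (a + b); pose m := pairing g (w k0).
have [_ _ cQ0 _] := sQ k0.
have gm x : Q x -> m <= pairing g x.
  move=> Qx; rewrite -subr_ge0 -pairingBr /g intcovecD pairingDl.
  by rewrite addr_ge0//; exact: cQ0.
have gF k : F k -> pairing g (w k) = m.
  move=> /pqP[ka kb _]; apply/eqP; rewrite eq_le gm ?andbT; last by case: (sQ k).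
  have [_ _ ck _] := sQ k; have [Q0 _ _ _] := sQ k0.
  rewrite -subr_ge0 -pairingBr /g intcovecD pairingDl -ka -kb.
  by rewrite addr_ge0//; exact: ck.
have gN k : ~~ F k -> m < pairing g (w k).
  move=> /asboolPn Fk; rewrite lt_neqAle gm ?andbT; last by case: (sQ k).
  apply/eqP => mk; apply: Fk.
  have [Qk _ _ _] := sQ k; have := cQ0 _ Qk i0; have := cQ0 _ Qk j0.
  rewrite -/a -/b !pairingBr => ha hb.
  move: mk; rewrite /m /g intcovecD !pairingDl => mk.
  split; apply: (facet_normal_at_vertex (sQ k0) (sQ k)); rewrite -/a -/b; lra.
(* the cut has to stay within the edges leaving the face and to avoid the
   vertices outside of it *)
have [e e0 eP] : exists2 e : R, 0 < e & forall k,
    (F k -> forall i, Q (w k + (e *+ 2) *: edge_dir (B k) i)) /\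
    (~~ F k -> m + e *+ 2 <= pairing g (w k)).
  have /choice[d dP] : forall k, exists d : R, 0 < d /\
      ((F k -> forall i, Q (w k + d *: edge_dir (B k) i)) /\
      (~~ F k -> m + d <= pairing g (w k))).
    move=> k; have [Qk _ _ [d d0 Qd]] := sQ k.
    case: (boolP (F k)) => Fk; first by exists d; split.
    exists (pairing g (w k) - m); split; first by rewrite subr_gt0 gN.
    by split=> // _; rewrite addrC subrK.
  have [e e0 ed] := finite_lower_bound (fun k => (dP k).1).
  exists (e / 2) => [|k]; first by rewrite divr_gt0.
  have -> : (e / 2) *+ 2 = e by lra.
  have [d0 [dF dN]] := dP k; split=> Fk.
    move=> i; apply: (convex_step (d := d k)) (dF Fk i) => //; last by case: (sQ k).
    by rewrite (ltW e0) ed.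
  by apply: le_trans (dN Fk); rewrite lerD2l.
pose w' (kb : K * bool) := if F kb.1 then
  w kb.1 + e *: edge_dir (B kb.1) (if kb.2 then (pq kb.1).1 else (pq kb.1).2)
  else w kb.1.
pose B' (kb : K * bool) := if F kb.1 then
  if kb.2 then shear (pq kb.1).1 (pq kb.1).2 (B kb.1)
  else shear (pq kb.1).2 (pq kb.1).1 (B kb.1) else B kb.1.
exists (K * bool)%type, (Q `&` [set x | m + e <= pairing g x]), w', B'; split.
- split; first exact: convex_halfspace.
  + move=> [k t]; rewrite /w' /B' /=; case: (boolP (F k)) => Fk; last first.
      by apply: smooth_vertex_cut => //; exact: (eP k).2.
    have [ka kb pqk] := pqP k Fk; rewrite -(gF k Fk).
    case: t.
      have := @smooth_vertex_shear Q (w k) (B k) (pq k).1 (pq k).2 e cQ (sQ k) pqk e0.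
      by rewrite /= ka kb; apply; exact: (eP k).1.
    rewrite eq_sym in pqk.
    have := @smooth_vertex_shear Q (w k) (B k) (pq k).2 (pq k).1 e cQ (sQ k) pqk e0.
    by rewrite /= ka kb [b + a]addrC; apply; exact: (eP k).1.
  + move=> f; have [k fk] := aQ f.
    case: (boolP (F k)) => Fk; last by exists (k, true) => i; rewrite /B' (negPf Fk).
    have [le|le] := leP (pairing f (edge_dir (B k) (pq k).2))
                        (pairing f (edge_dir (B k) (pq k).1)).
      exists (k, true) => i; rewrite /B' /= Fk edge_dir_shear.
      by case: eqP => // _; rewrite pairingBr subr_le0.
    exists (k, false) => i; rewrite /B' /= Fk edge_dir_shear.
    by case: eqP => // _; rewrite pairingBr subr_le0 ltW.
- move=> [k t]; exists k => c; rewrite /B' /=; case: (boolP (F k)) => Fk; last by left.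
  have [ka kb pqk] := pqP k Fk; case: t.
    move=> /(ray_shear pqk (uB k))[[]|]; first by left.
    by rewrite ka kb => ->; right; split=> //; [exists (pq k).1|exists (pq k).2].
  rewrite eq_sym in pqk; move=> /(ray_shear pqk (uB k))[[]|]; first by left.
  by rewrite ka kb addrC => ->; right; split=> //; [exists (pq k).1|exists (pq k).2].
- have rayB k c : is_ray (B k) c -> exists u, ipairing c u = 1.
    by move=> [i <-]; exists (row i (B k)); rewrite ipairing_dual// eqxx.
  have aNab : a <> a + b.
    rewrite -{1}[a]addr0 => /addrI b0; have [|u] := rayB k0 b; first by exists j0.
    by rewrite -b0 /ipairing mulmx0 mxE => /eqP; rewrite eq_sym oner_eq0.
  have bNab : b <> a + b.
    rewrite -{1}[b]add0r => /addIr b0; have [|u] := rayB k0 a; first by exists i0.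
    by rewrite -b0 /ipairing mulmx0 mxE => /eqP; rewrite eq_sym oner_eq0.
  move=> [k t]; rewrite /B' /=; case: (boolP (F k)) => [Fk|/asboolPn//].
  have [ka kb pqk] := pqP k Fk; case: t => -[ra rb].
    have [[]|] := ray_shear pqk (uB k) ra; first by rewrite ka.
    by rewrite ka kb.
  rewrite eq_sym in pqk; have [[]|] := ray_shear pqk (uB k) rb; first by rewrite kb.
  by rewrite ka kb addrC.
Qed.

End BlowUp.

(** * Resolution of hyperplane arrangements *)

Section Resolution.
Context {R : realType} {n : nat}.
Implicit Types (u v : 'rV[int]_n) (M : 'M[int]_n) (K : finType).

(** The hyperplane orthogonal to [u] does not cut the dual cone of [M]. *)
Definition same_sign M u :=
  (forall i, 0 <= ipairing (facet_normal M i) u) \/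
  (forall i, ipairing (facet_normal M i) u <= 0).

Lemma cube_model : exists (K : finType) (Q : set 'rV[R]_n) (w : K -> 'rV[R]_n)
  (B : K -> 'M[int]_n), smooth_model Q w B.
Proof.
pose w (f : {ffun 'I_n -> bool}) : 'rV[R]_n := \row_i (f i)%:R.
pose B (f : {ffun 'I_n -> bool}) : 'M[int]_n := diag_mx (\row_i (-1) ^+ f i).
have BB f : B f *m B f = 1%:M.
  rewrite mulmx_diag; apply/matrixP => i j; rewrite !mxE; congr (_ *+ _).
  by rewrite -expr2 sqrr_sign.
have uB f : B f \in unitmx by case: (mulmx1_unit (BB f)).
have dirE f i : edge_dir (B f) i = (-1) ^+ f i *: delta_mx 0 i :> 'rV[R]_n.
  apply/rowP => j; rewrite !mxE /= [j == i]eq_sym.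
  by case: (i == j); rewrite ?mulr1n ?mulr0n ?mulr1 ?mulr0// rmorph_sign.
have normalE f i (x : 'rV[R]_n) :
    pairing (intcovec (facet_normal (B f) i)) x = (-1) ^+ f i * x 0 i.
  have -> : facet_normal (B f) i = (-1) ^+ f i *: delta_mx i 0.
    rewrite /facet_normal; have -> : invmx (B f) = B f.
      by apply: (can_inj (mulKmx (uB f))); rewrite mulmxV.
    apply/colP => j; rewrite !mxE /= andbT.
    by case: eqP => [->|_]; rewrite ?mulr1n ?mulr0n ?mulr1 ?mulr0.
  rewrite pairingE (bigD1 i)//= big1 ?addr0 => [|j ji].
    by rewrite !mxE !eqxx mulr1 rmorph_sign mulrC.
  by rewrite !mxE (negPf ji) mulr0 mulr0.
exists {ffun 'I_n -> bool}, [set x | forall i, 0 <= x 0 i <= 1], w, B; split.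
- move=> x y t Qx Qy /andP[t0 t1] i; rewrite !mxE.
  by have /andP[? ?] := Qx i; have /andP[? ?] := Qy i; apply/andP; split; nra.
- move=> f; split=> //.
  + by move=> i; rewrite !mxE; case: (f i); rewrite ?lexx ?ler01.
  + move=> x Qx i; rewrite normalE !mxE; have := Qx i.
    by case: (f i); rewrite ?expr1 ?expr0/=; lra.
  + exists 1 => // i j; rewrite dirE scale1r !mxE /=.
    by case: eqP => [->|_]; case: (f _); rewrite /=; lra.
- move=> a; exists [ffun i => 0 < a i 0] => i; rewrite dirE pairingZr.
  rewrite pairingE (bigD1 i)//= big1 ?addr0 => [|j ji].
    rewrite !mxE !eqxx mul1r ffunE; case: ltP => /=; lra.
  by rewrite !mxE (negPf ji) mul0r.
Qed.

Lemma same_signP M u :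
  ~ same_sign M u -> exists a b, [/\ is_ray M a, is_ray M b,
    ipairing a u < 0 & 0 < ipairing b u].
Proof.
move=> /not_orP[/existsNP[i /negP] + /existsNP[j /negP]]; rewrite -!ltNge => ui uj.
by exists (facet_normal M i), (facet_normal M j); split=> //; [exists i|exists j].
Qed.

(** The last clause makes it possible to treat several vectors in succession. *)
Definition refinable K (B : K -> 'M[int]_n) u :=
  exists (K' : finType) (Q' : set 'rV[R]_n) (w' : K' -> 'rV[R]_n)
    (B' : K' -> 'M[int]_n), [/\ smooth_model Q' w' B',
      forall k, same_sign (B' k) u &
      forall v, (forall k, same_sign (B k) v) -> forall k, same_sign (B' k) v].

Definition crossing K (B : K -> 'M[int]_n) u (a b : 'cV[int]_n) :=
  exists k, [/\ is_ray (B k) a, is_ray (B k) b, ipairing a u < 0 & 0 < ipairing b u].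

Definition width_le K (B : K -> 'M[int]_n) u (S : nat) :=
  forall a b, crossing B u a b -> ipairing b u - ipairing a u <= S%:Z.

Lemma width_le0 K Q w (B : K -> 'M[int]_n) u :
  @smooth_model R n K Q w B -> width_le B u 0 -> refinable B u.
Proof.
move=> mQ wB; exists K, Q, w, B; split=> // k; apply: contrapT => /same_signP[a [b [ra rb a0 b0]]].
have : ipairing b u - ipairing a u <= 0 by apply: wB; exists k.
by rewrite subr_le0 leNgt (lt_trans a0 b0).
Qed.

(** The value of [u] at [a + b] lies strictly between its values at [a] and [b].
    Hence the subdivision of a crossing pair [(a, b)] of maximal width creates
    only pairs of smaller width: a ray [c] that forms a crossing pair with
    [a + b] lies in a common cone with [a] and [b], and already forms a wider
    crossing pair with one of them. *)
Lemma width_le_succ u S :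
  (forall K Q w (B : K -> 'M[int]_n), @smooth_model R n K Q w B ->
     width_le B u S -> refinable B u) ->
  forall K Q w (B : K -> 'M[int]_n), @smooth_model R n K Q w B ->
     width_le B u S.+1 -> refinable B u.
Proof.
move=> IHS K0 Q0 w0 B0 mQ0 wB0.
pose rays := [seq facet_normal (B0 k) i | k <- enum K0, i <- enum 'I_n].
have ray_mem k a : is_ray (B0 k) a -> a \in rays.
  by move=> [i <-]; apply/allpairsP; exists (k, i); rewrite !mem_enum.
have : forall a b, crossing B0 u a b -> ipairing b u - ipairing a u = S.+1%:Z ->
    (a, b) \in [seq (a, b) | a <- rays, b <- rays].
  move=> a b [k [ra rb _ _]] _; apply/allpairsP; exists (a, b).
  by rewrite (ray_mem _ _ ra) (ray_mem _ _ rb).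
move: [seq (a, b) | a <- rays, b <- rays] => L.
(* [L] contains the pairs of maximal width; each subdivision removes one *)
have [m] := ubnP (size L); elim: m => // m IHm in L K0 Q0 w0 B0 mQ0 wB0 {rays ray_mem} *.
rewrite ltnS => Lm BL.
have [[a [b [ab abS]]]|noab] := pselect (exists a b, crossing B0 u a b /\
    ipairing b u - ipairing a u = S.+1%:Z); last first.
  apply: IHS mQ0 _ => a b ab; rewrite -ltzD1 -PoszD addn1; have := wB0 _ _ ab.
  rewrite le_eqVlt => /orP[/eqP abS|//]; exfalso; apply: noab; by exists a, b.
have abL := BL _ _ ab abS; have [k0 [[i ia] [j jb] a0 b0]] := ab.
have ij : i != j.
  apply/eqP => ij; move: a0 b0; rewrite -ia -jb ij => x y.
  by have := lt_trans x y; rewrite ltxx.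
have [K' [Q' [w' [B' [mQ' rB' nB']]]]] := blow_up k0 mQ0 ij.
rewrite ia jb in rB' nB'.
have crossing' c d : crossing B' u c d -> [/\ crossing B0 u c d, (c, d) != (a, b) &
      ipairing d u - ipairing c u <= S.+1%:Z] \/
    ipairing d u - ipairing c u < S.+1%:Z.
  move=> [k' [rc rd c0 d0]]; have [k kP] := rB' k'.
  have Bk x y : is_ray (B0 k) x -> is_ray (B0 k) y -> ipairing x u < 0 ->
    0 < ipairing y u -> ipairing y u - ipairing x u <= S.+1%:Z.
    by move=> *; apply: wB0; exists k.
  have [rc0|[cE ra rb]] := kP _ rc; have [rd0|[dE ra' rb']] := kP _ rd.
  - left; split; [by exists k| |exact: Bk].
    by apply/eqP => -[ca db]; apply: (nB' k'); rewrite -ca -db.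
  - right; have := Bk _ _ rc0 rb' c0 b0; rewrite dE ipairingDl; lra.
  - right; have := Bk _ _ ra rd0 a0 d0; rewrite cE ipairingDl; lra.
  - by exfalso; move: c0 d0; rewrite cE dE => x y; have := lt_trans x y; rewrite ltxx.
have [| | |K2 [Q2 [w2 [B2 [mQ2 sB2 tB2]]]]] :=
    IHm [seq x <- L | x != (a, b)] K' Q' w' B' mQ'.
- by move=> c d /crossing'[[]//|/ltW].
- apply: leq_trans Lm; rewrite size_filter -(count_predC (pred1 (a, b)) L).
  by rewrite -add1n leq_add2r -has_count has_pred1.
- move=> c d /crossing'[[cd cdab _] cdS|cd cdS]; last by move: cd; rewrite cdS ltxx.
  by rewrite mem_filter cdab BL.
exists K2, Q2, w2, B2; split=> // v vB; apply: tB2 => k'.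
have [k kP] := rB' k'; case: (vB k) => [pos|neg]; [left|right] => l.
  have [[r <-]|[-> [p <-] [q <-]]] := kP _ (ex_intro _ l erefl); first exact: pos.
  by rewrite ipairingDl addr_ge0.
have [[r <-]|[-> [p <-] [q <-]]] := kP _ (ex_intro _ l erefl); first exact: neg.
by rewrite ipairingDl -[0]addr0 lerD.
Qed.

Lemma model_refinable K Q w (B : K -> 'M[int]_n) u :
  @smooth_model R n K Q w B -> refinable B u.
Proof.
suff [S wS] : exists S, width_le B u S.
  elim: S K Q w B wS => [|S IHS] K Q w B wB mQ; first exact: width_le0 mQ wB.
  by apply: width_le_succ mQ wB => K' Q' w' B' mQ' wB'; exact: IHS wB' mQ'.
pose val k i := ipairing (facet_normal (B k) i) u.
exists (\sum_k \sum_i \sum_j `|val k j - val k i|)%N => a b [k [[i <-] [j <-] _ _]].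
apply: le_trans (lez_abs _) _; rewrite lez_nat.
rewrite (bigD1 k)//= (bigD1 i)//= (bigD1 j)//= -!addnA; exact: leq_addr.
Qed.

(** Starting from the cube, whose normal fan is unimodular, make the vectors [u]
    of constant sign on the cones one after the other. *)
Lemma common_resolution (us : seq 'rV[int]_n) :
  exists (K : finType) (Q : set 'rV[R]_n) (w : K -> 'rV[R]_n) (B : K -> 'M[int]_n),
    smooth_model Q w B /\ forall k u, u \in us -> same_sign (B k) u.
Proof.
elim: us => [|u us [K [Q [w [B [mQ usB]]]]]].
  by have [K [Q [w [B mQ]]]] := cube_model; exists K, Q, w, B.
have [K' [Q' [w' [B' [mQ' uB' vB']]]]] := model_refinable u mQ.
exists K', Q', w', B'; split=> // k v; rewrite inE => /orP[/eqP ->//|vus].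
by apply: vB' => k'; exact: usB.
Qed.

End Resolution.

(** * Edges of polytopes and compatible cones *)

Section VertexCone.
Context {R : realType} {n : nat}.
Implicit Types (P E : set 'rV[R]_n) (v : 'rV[R]_n) (C : set 'rV[R]_n).

Record convex_cone C : Prop := ConvexCone {
  cone0 : C 0;
  coneD : forall x y, C x -> C y -> C (x + y);
  coneZ : forall (t : R) x, 0 <= t -> C x -> C (t *: x) }.

Lemma cone_sum C (I : Type) (r : seq I) (p : pred I) (F : I -> 'rV[R]_n) :
  convex_cone C -> (forall i, p i -> C (F i)) -> C (\sum_(i <- r | p i) F i).
Proof. by move=> [c0 cD _] CF; elim/big_ind: _ => // x y; exact: cD. Qed.

Lemma convex_cone_in_cone (B : 'M[int]_n) : convex_cone (in_cone B).
Proof.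
split=> [i|x y xB yB i|t x t0 xB i]; first by rewrite pairing0r.
  by rewrite pairingDr addr_ge0.
by rewrite pairingZr mulr_ge0.
Qed.

Lemma cone_conv_hull k (g : 'I_k -> 'rV[R]_n) C v x : convex_cone C ->
  (forall i, C (g i - v)) -> conv_hull g x -> C (x - v).
Proof.
move=> cC gC [t [t0 t1] <-].
have -> : \sum_i t i *: g i - v = \sum_i t i *: (g i - v).
  under [RHS]eq_bigr do rewrite scalerBr.
  by rewrite sumrB -scaler_suml t1 scale1r.
by apply: cone_sum => // i _; exact: coneZ.
Qed.

(** A polytope is contained in the cone spanned by its edges at any given
    vertex.  A minimal family of generators of this cone consists of edge
    directions: the functional exposing an edge is given by Gordan's
    alternative, applied after projection along the generator. *)
Lemma edges_generate P v C : is_polytope P -> is_vertex P v -> convex_cone C ->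
  (forall E y, edges_at P v E -> E y -> C (y - v)) ->
  forall x, P x -> C (x - v).
Proof.
move=> pP [a0 [c0 [a0P vE]]] cC EC x; have [k [g PE]] := pP.
have Pg i : P (g i) by rewrite PE; exact: conv_hull_gen.
have [Pv a0v] : P v /\ pairing a0 v = c0.
  by have : [set v] v by []; rewrite vE => -[].
have a0_le j : pairing a0 (g j - v) <= 0 by rewrite pairingBr a0v subr_le0 a0P.
have a0_lt j : g j - v != 0 -> pairing a0 (g j - v) < 0.
  move=> gv; rewrite lt_neqAle a0_le andbT; apply: contra gv => /eqP.
  rewrite pairingBr a0v => /eqP; rewrite subr_eq0 => /eqP gj.
  have : [set v] (g j) by rewrite vE; split.
  by move=> /= ->; rewrite subrr.
pose gen (J : {set 'I_k.+1}) := `[< forall D, convex_cone D ->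
  (forall m, m \in J -> D (g m - v)) -> forall j, D (g j - v) >].
have genT : gen [set: 'I_k.+1]%SET by apply/asboolP => D _ h j; apply: h; rewrite inE.
have [J /asboolP genJ minJ] := arg_minnP (fun J : {set 'I_k.+1} => #|J|) genT.
have notgen i : i \in J -> ~ gen (J :\ i)%SET.
  move=> iJ /minJ; rewrite (cardsD1 i J) iJ add1n ltnn.
  by [].
suff JC i : i \in J -> C (g i - v).
  by rewrite PE; apply: cone_conv_hull => // j; exact: genJ.
move=> iJ.
have nz m : m \in J -> g m - v != 0.
  move=> mJ; apply/negP => /eqP g0; apply: (notgen m mJ); apply/asboolP => D cD DJ.
  apply: genJ => // l lJ; have [->|lm] := eqVneq l m; first by rewrite g0; case: cD.
  by apply: DJ; rewrite !inE lm.
have gi0 := a0_lt i (nz i iJ).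
pose r (j : 'I_k.+1) := pairing a0 (g j - v) / pairing a0 (g i - v).
have [[t [t0 [l tl] tg]]|[a aw]] :=
    gordan (fun l : {l : 'I_k.+1 | l \in (J :\ i)%SET} => (g (val l) - v) - r (val l) *: (g i - v)).
  (* the projections have a vanishing nonnegative combination, so [g i - v] is
     redundant *)
  exfalso; apply: (notgen i iJ); apply/asboolP => D cD DJ.
  apply: genJ => // m mJ; have [->|mi] := eqVneq m i; last by apply: DJ; rewrite !inE mi.
  pose mu := \sum_l t l * r (val l).
  have r0 (j : {l : 'I_k.+1 | l \in (J :\ i)%SET}) : 0 < r (val j).
    have := valP j; rewrite !inE => /andP[_ jJ]; rewrite /r -mulrNN -invrN.
    by rewrite divr_gt0 ?oppr_gt0//; exact: a0_lt (nz _ jJ).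
  have mu0 : 0 < mu.
    rewrite /mu (bigD1 l)//= ltr_pwDl//; first by rewrite pmulr_rgt0 ?r0.
    by apply: sumr_ge0 => j _; rewrite mulr_ge0//; exact: ltW (r0 j).
  have -> : g i - v = mu^-1 *: \sum_l t l *: (g (val l) - v).
    move: tg; under eq_bigr do rewrite scalerBr scalerA.
    rewrite sumrB -scaler_suml => /eqP; rewrite subr_eq0 => /eqP ->.
    by rewrite scalerA mulVf ?scale1r ?gt_eqF.
  apply: coneZ => //; first by rewrite invr_ge0 ltW.
  by apply: cone_sum => // j _; apply: coneZ => //; apply: DJ; exact: valP.
pose a' := a - (pairing a (g i - v) / pairing a0 (g i - v)) *: a0.
have a'i : pairing a' (g i - v) = 0.
  by rewrite pairingBl pairingZl divfK ?subrr// lt_eqF.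
have a'l m : m \in (J :\ i)%SET -> pairing a' (g m - v) < 0.
  move=> mJ; suff <- : pairing a (g m - v - r m *: (g i - v)) = pairing a' (g m - v).
    exact: aw (exist _ m mJ).
  rewrite [LHS]pairingBr [RHS]pairingBl pairingZr pairingZl /r; congr (_ - _).
  by rewrite mulrC mulrA mulrAC.
pose D : set 'rV[R]_n := [set y | pairing a' y <= 0 /\
  (pairing a' y = 0 -> exists2 s : R, 0 <= s & y = s *: (g i - v))].
have cD : convex_cone D.
  split.
  - by split; [rewrite pairing0r|move=> _; exists 0; rewrite ?scale0r].
  - move=> y z [y1 y2] [z1 z2]; split; first by rewrite pairingDr -[0]addr0 lerD.
    rewrite pairingDr => yz; have [|s s0 ->] := y2 _; first by lra.
    have [|s' s'0 ->] := z2 _; first by lra.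
    by exists (s + s'); rewrite ?addr_ge0// scalerDl.
  - move=> t y t0 [y1 y2]; split; first by rewrite pairingZr mulr_ge0_le0.
    have [->|tn0] := eqVneq t 0; first by exists 0; rewrite ?scale0r.
    rewrite pairingZr => /eqP; rewrite mulf_eq0 (negPf tn0)/= => /eqP/y2[s s0 ->].
    by exists (t * s); rewrite ?mulr_ge0// scalerA.
have PD y : P y -> D (y - v).
  rewrite PE; apply: cone_conv_hull => //; apply: genJ => // m mJ.
  have [->|mi] := eqVneq m i.
    by split; [rewrite a'i|move=> _; exists 1; rewrite ?scale1r].
  have a'm : pairing a' (g m - v) < 0 by apply: a'l; rewrite !inE mi.
  by split; [exact: ltW|move=> a'm0; move: a'm; rewrite a'm0 ltxx].
apply: (EC (P `&` [set y | pairing a' y = pairing a' v])); last first.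
  by split=> //=; apply/eqP; rewrite -subr_eq0 -pairingBr a'i.
have Ev : (P `&` [set y | pairing a' y = pairing a' v]) v by split.
split=> //; split.
  exists a', (pairing a' v); split=> // y /PD[+ _].
  by rewrite pairingBr subr_le0.
split; first by exists v.
have Es y : (P `&` [set y | pairing a' y = pairing a' v]) y ->
    exists s : R, y - v = s *: (g i - v).
  move=> [/PD[_ yD] /= yv]; have [|s _ ->] := yD; last by exists s.
  by rewrite pairingBr yv subrr.
exists <[g i - v]>%VS; split; first by rewrite dim_vline nz.
  move=> y z /Es[s ys] /Es[s' zs]; rewrite -(subrKA v) -(opprB z) ys zs.
  by apply: rpredB; rewrite memvZ// memv_line.
move=> W WE; rewrite -memvE; apply: WE => //; split=> //=.
by apply/eqP; rewrite -subr_eq0 -pairingBr a'i.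
Qed.

Lemma primitive_vecN (u : 'rV[int]_n) : primitive_vec u -> primitive_vec (- u).
Proof.
move=> pu; rewrite /primitive_vec; set d := \big[_/_]_(_ < _) _.
apply: (primitive_dvdz pu) => [|i]; first exact: biggcd_ge0.
by have := biggcd_dvdz (- u) i; rewrite [(- u) 0 i]mxE rpredN.
Qed.

Lemma primitive_direction (u : 'rV[int]_n) (t : R) : t *: intvec u != 0 ->
  exists (u' : 'rV[int]_n) (s : R),
    [/\ primitive_vec u', 0 < s & t *: intvec u = s *: intvec u'].
Proof.
rewrite scaler_eq0 negb_or intvec_eq0 => /andP[t0 /primitive_part[d [u' [d0 pu' ->]]]].
rewrite intvecZ scalerA; have [t_gt0|t_le0] := ltP 0 t.
  by exists u', (t * d%:~R); split=> //; rewrite mulr_gt0// ltr0z.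
exists (- u'), (- t * d%:~R); split; first exact: primitive_vecN.
  by rewrite mulr_gt0 ?ltr0z// oppr_gt0 lt_neqAle t0.
by rewrite /intvec map_mxN scalerN mulNr scaleNr opprK.
Qed.

(** The edges at [v] generate a cone containing [P], and by rationality each of
    them has a primitive direction, which belongs to the given basis. *)
Lemma delzant_smooth_vertex P v : is_delzant P -> is_vertex P v ->
  exists B, smooth_vertex P v B.
Proof.
move=> [pP _ _ ratP zP] vP; have [B rB /is_ZbasisP uB] := zP v vP.
have Pv : P v by have [a [c [_ vE]]] := vP; have : [set v] v by []; rewrite vE => -[].
exists B; split=> //.
  apply: edges_generate => //; first exact: convex_cone_in_cone.
  move=> E y [eE Ev] Ey; have [->|yv] := eqVneq y v.
    by rewrite subrr; case: (convex_cone_in_cone B).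
  have [u uE] := ratP E eE; have [t tE] := uE v y Ev Ey.
  have [|u' [s [pu' s0 sE]]] := @primitive_direction u t.
    by rewrite -tE subr_eq0.
  have : primitive_edge_vectors P v u'.
    split=> //; exists E; first by split.
    by exists s => //; rewrite -sE -tE subrKC.
  rewrite -rB => -[i _ iu'] j.
  by rewrite tE sE -iu' pairingZr (pairing_dual j i uB) mulr_ge0 ?ler0n ?ltW.
have /choice[d dP] : forall i, exists d : R, 0 < d /\ P (v + d *: edge_dir B i).
  move=> i; have : primitive_edge_vectors P v (row i B) by rewrite -rB; exists i.
  move=> [_ [E [[[a [c [_ EE]]] _] _] [t t0 Et]]]; exists t; split=> //.
  by move: Et; rewrite EE => -[].
have [e e0 ed] := finite_lower_bound (fun i => (dP i).1).
exists e => // i; have [d0 Pd] := dP i.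
apply: (convex_step (d := d i)) => //; first exact: polytope_convex.
by rewrite (ltW e0) ed.
Qed.

End VertexCone.

Section Compatibility.
Context {R : realType} {n : nat}.
Implicit Types (P Q : set 'rV[R]_n) (M : 'M[int]_n).

(** Equivalently, the functionals that are nonpositive on the cone of [M] lie in
    a single normal cone of [P]. *)
Definition compatible P M := exists2 p, P p & forall x, P x -> in_cone M (x - p).

Lemma avoid_roots (s : seq {poly R}) : all (fun p => p != 0) s ->
  exists2 t : R, 0 < t & forall p, p \in s -> p.[t] != 0.
Proof.
move=> s0; pose q := \prod_(p <- s) p.
have q0 : q != 0.
  by rewrite prodf_seq_neq0; apply: sub_all s0 => p ->.
have [t t0 qt] : exists2 t : R, 0 < t & q.[t] != 0.
  apply: contrapT => noroot; pose rs := [seq i.+1%:R : R | i <- iota 0 (size q)].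
  have := @max_poly_roots _ q rs q0; rewrite size_map size_iota ltnn.
  have -> : all (root q) rs.
    apply/allP => _ /mapP[i _ ->]; rewrite rootE; apply: contrapT => /negP qi.
    by apply: noroot; exists i.+1%:R.
  have -> : uniq rs.
    by rewrite map_inj_uniq ?iota_uniq// => i j /eqP; rewrite eqr_nat => /eqP[].
  by move=> /(_ isT isT).
exists t => // p ps; apply: contra qt => /eqP pt0.
by rewrite /q horner_prod prodf_seq_eq0; apply/hasP; exists p => //=; rewrite pt0.
Qed.

(** In the interior of the dual cone of a unimodular cone, some functional
    avoids any given finite set of hyperplanes: the moment curve
    [t |-> (1, t, t ^+ 2, ...)] meets each of them finitely many times. *)
Lemma generic_functional M (s : seq 'rV[R]_n) : M \in unitmx ->
  exists c : 'I_n -> R, (forall i, 0 < c i) /\ forall y, y \in s -> y != 0 ->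
    pairing (- \sum_i c i *: intcovec (facet_normal M i)) y != 0.
Proof.
move=> uM; pose pol (y : 'rV[R]_n) : {poly R} :=
  \sum_i pairing (intcovec (facet_normal M i)) y *: 'X^i.
have pol0 y : y != 0 -> pol y != 0.
  apply: contra => /eqP p0; apply/eqP; rewrite (edge_decomposition y uM) big1// => i _.
  have /polyP/(_ i) := p0; rewrite coef0 /pol coef_sum (bigD1 i)//= coefZ coefXn eqxx mulr1.
  rewrite big1 ?addr0 => [->|j ji]; first by rewrite scale0r.
  by rewrite coefZ coefXn (inj_eq val_inj) eq_sym (negPf ji) mulr0.
have [|t t0 tP] := @avoid_roots [seq pol y | y <- s & y != 0].
  by apply/allP => _ /mapP[y + ->]; rewrite mem_filter => /andP[/pol0].
exists (fun i => t ^+ i); split=> [i|y ys y0]; first exact: exprn_gt0.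
rewrite pairingNl oppr_eq0 pairing_suml.
have -> : \sum_(i < n) pairing (t ^+ i *: intcovec (facet_normal M i)) y = (pol y).[t].
  rewrite /pol horner_sum; apply: eq_bigr => i _.
  by rewrite pairingZl hornerZ hornerXn mulrC.
by apply: tP; apply: map_f; rewrite mem_filter y0.
Qed.

(** If no edge direction of [P] changes sign on the dual cone of [M], then a
    vertex of [P] at which an interior functional of that cone is maximal
    maximizes all its functionals. *)
Lemma delzant_compatible P : is_delzant P -> exists us : seq 'rV[int]_n,
  forall M, M \in unitmx -> (forall u, u \in us -> same_sign M u) -> compatible P M.
Proof.
move=> dP; have [pP _ _ _ _] := dP; have [k [v PE]] := pP.
have Pv j : P (v j) by rewrite PE; exact: conv_hull_gen.
have /choice[B BP] : forall j, exists B, is_vertex P (v j) -> smooth_vertex P (v j) B.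
  move=> j; have [vj|nvj] := pselect (is_vertex P (v j)); last by exists 0.
  by have [B] := delzant_smooth_vertex dP vj; exists B.
exists [seq row i (B j) | j <- enum 'I_k.+1, i <- enum 'I_n] => M uM sM.
have [c [c0 cP]] := generic_functional [seq v i - v j | i <- enum 'I_k.+1, j <- enum 'I_k.+1] uM.
set a := - \sum_i _ in cP.
have [j jmax] : exists j, forall i, pairing a (v i) <= pairing a (v j).
  exists [arg max_(i > ord0) pairing a (v i)]%O => i.
  by case: arg_maxP => // j _; apply.
have jP x : P x -> pairing a x <= pairing a (v j).
  by rewrite PE; apply: pairing_conv_hull_le.
have vj : is_vertex P (v j).
  exists a, (pairing a (v j)); split=> //; apply/seteqP; split=> [_ -> //|x [Px ax]].
  move: Px; rewrite PE => -[t [t0 t1] tx]; rewrite /= -tx -[v j]scale1r -t1 scaler_suml.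
  apply: eq_bigr => i _; have [-> //|vij] := eqVneq (v i) (v j).
  have /eqP : \sum_i t i * pairing a (v j - v i) = 0.
    under eq_bigr do rewrite pairingBr mulrBr.
    rewrite sumrB -mulr_suml t1 mul1r -ax -tx pairing_sumr.
    by under [X in _ - X]eq_bigr do rewrite -pairingZr; rewrite subrr.
  rewrite psumr_eq0 => [/allP h|l _]; last by rewrite mulr_ge0// pairingBr subr_ge0.
  have /implyP/(_ isT) := h i (mem_index_enum i); rewrite mulf_eq0 => /orP[/eqP ->|].
    by rewrite !scale0r.
  rewrite (negPf (cP _ _ _))//; last by rewrite subr_eq0 eq_sym.
  by apply/allpairsP; exists (j, i); rewrite !mem_enum.
have sj := BP j vj; have [_ uB cB _] := sj.
exists (v j) => // x Px; rewrite (edge_decomposition (x - v j) uB).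
apply: cone_sum; first exact: convex_cone_in_cone.
move=> i _; apply: (coneZ (convex_cone_in_cone M)); first exact: cB.
have ai := tangent_functional_le0 sj jP i.
have : same_sign M (row i (B j)).
  by apply: sM; apply/allpairsP; exists (j, i); rewrite !mem_enum.
rewrite /edge_dir => -[pos l|neg l]; first by rewrite pairing_int ler0z.
have := ai; rewrite /a pairingNl pairing_suml oppr_le0 => sum_ge0.
have : \sum_i0 pairing (c i0 *: intcovec (facet_normal M i0)) (edge_dir (B j) i) == 0.
  rewrite eq_le sum_ge0 andbT; apply: sumr_le0 => m _.
  by rewrite pairingZl mulr_ge0_le0 ?(ltW (c0 m))// pairing_int lerz0.
rewrite -oppr_eq0 -sumrN psumr_eq0 => [/allP h|m _]; last first.
  by rewrite oppr_ge0 pairingZl mulr_ge0_le0 ?(ltW (c0 m))// pairing_int lerz0.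
have /implyP/(_ isT) := h l (mem_index_enum l).
by rewrite oppr_eq0 pairingZl mulf_eq0 (gt_eqF (c0 l))/= => /eqP ->.
Qed.

End Compatibility.

(** * Normal fans and their coarsenings *)

Section NormalFans.
Context {R : realType} {n : nat}.
Implicit Types (P Q F : set 'rV[R]_n) (a b c : 'cV[R]_n).

(** A functional [c] is an interior point of the normal cone of the face that
    it exposes: it can be moved away from any other functional [b] of the cone. *)
Lemma normal_cone_interior Q c b p : is_polytope Q -> Q p ->
  (forall x, Q x -> pairing c x <= pairing c p) ->
  let F := Q `&` [set x | pairing c x = pairing c p] in
  normal_cone Q F b -> exists2 e : R, 0 < e & normal_cone Q F (c - e *: b).
Proof.
move=> pQ Qp cp F Fb; have [k [v QE]] := pQ.
have Qv i : Q (v i) by rewrite QE; exact: conv_hull_gen.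
have Fp : F p by [].
have bF x : F x -> pairing b x = pairing b p.
  move=> Fx; have := Fb _ _ Fx Qp; have [Qx _] := Fx; have := Fb _ _ Fp Qx.
  by rewrite !pairingBr; lra.
pose out i := pairing c (v i) != pairing c p.
have [|e e0 eP] := @small_perturbation R _
    (fun i => if out i then pairing c (v i - p) else -1)
    (fun i => if out i then - pairing b (v i - p) else 0).
  move=> i; case: ifPn => [oi|_]; last by rewrite oppr_lt0.
  by rewrite pairingBr subr_lt0 lt_neqAle cp// andbT.
exists e => // x q [Qx /= cx] Qq.
have -> : pairing (c - e *: b) (x - q) = pairing (c - e *: b) (p - q).
  by rewrite !pairingBr !pairingBl !pairingZl cx (bF x).
rewrite pairingBr subr_ge0; move: Qq; rewrite QE; apply: pairing_conv_hull_le => i.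
have := eP i; rewrite /out; case: ifPn => [_|]; last first.
  rewrite negbK => /eqP ci _; have Fi : F (v i) by [].
  by rewrite !pairingBl !pairingZl ci (bF _ Fi).
by rewrite !pairingBr !pairingBl !pairingZl; lra.
Qed.

Lemma common_maximizer P c b (e : R) p y : 0 < e -> P p -> P y ->
  (forall x, P x -> pairing c x <= pairing c y) ->
  (forall x, P x -> pairing b x <= pairing b p) ->
  (forall x, P x -> pairing (c - e *: b) x <= pairing (c - e *: b) p) ->
  pairing b y = pairing b p.
Proof.
move=> e0 Pp Py cy bp gp; apply/eqP; rewrite eq_le bp//=.
have := gp _ Py; rewrite !pairingBl !pairingZl; have := cy _ Pp => ? ?.
by rewrite -(ler_pM2l e0); lra.
Qed.

Lemma smooth_vertex_is_vertex P w B : smooth_vertex P w B -> is_vertex P w.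
Proof.
move=> [Pw uB cB _]; pose a : 'cV[R]_n := \sum_i intcovec (facet_normal B i).
have aE x : pairing (- a) x = pairing (- a) w - \sum_i pairing (intcovec (facet_normal B i)) (x - w).
  by rewrite -pairing_suml -/a pairingBr !pairingNl; lra.
exists (- a), (pairing (- a) w); split=> [x Px|].
  by rewrite aE gerBl; apply: sumr_ge0 => i _; exact: cB.
apply/seteqP; split=> [_ -> //|x [Px /=]].
rewrite aE => /eqP; rewrite -subr_eq0 addrAC subrr add0r oppr_eq0.
rewrite psumr_eq0 => [/allP h|i _]; last exact: cB.
apply/eqP; rewrite -subr_eq0 (edge_decomposition (x - w) uB) big1// => i _.
by have /implyP/(_ isT)/eqP -> := h i (mem_index_enum i); rewrite scale0r.
Qed.

(** A face of [Q] contains some [w k], so the functionals of its normal cone are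
    all maximal over [P] at one point [p].  If [a] exposes that face, another
    functional [b] of the cone is maximal not only at [p] but on the whole face
    of [P] exposed by [a], because [a - e b] still belongs to the cone. *)
Lemma model_refines (K : finType) Q w B P : @smooth_model R n K Q w B ->
  is_polytope P -> (forall k, compatible P (B k)) ->
  refines (normal_fan Q) (normal_fan P).
Proof.
move=> mQ pP cP _ [F [fF F0] <-]; have [k Fk] := model_face_vertex mQ fF F0.
have [a [c [ac FE]]] := fF.
have [Qk ck] : Q (w k) /\ pairing a (w k) = c by move: Fk; rewrite FE => -[].
have [y Py aPy] := polytope_max a pP.
exists (normal_cone P (P `&` [set x | pairing a x = pairing a y])).
  exists (P `&` [set x | pairing a x = pairing a y]) => //; split; last by exists y.
  by exists a, (pairing a y).
have [p Pp pP'] := cP k; have [_ uB _ _] := model_vertex mQ k.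
have pmax d : normal_cone Q F d -> forall x, P x -> pairing d x <= pairing d p.
  move=> Fd x Px; rewrite -subr_le0 -pairingBr.
  apply: in_cone_pairing_le0 uB (pP' x Px) _.
  apply: tangent_functional_le0 (model_vertex mQ k) _ => z Qz.
  by have := Fd _ _ Fk Qz; rewrite pairingBr subr_ge0.
move=> b Fb z q [Pz /= az] Pq; have [||e e0 Fe] := @normal_cone_interior Q a b (w k) (model_polytope mQ) Qk.
- by move=> x /ac; rewrite ck.
- by rewrite ck -FE.
rewrite ck -FE in Fe.
have -> : pairing b (z - q) = pairing b p - pairing b q.
  rewrite pairingBr; congr (_ - _).
  by apply: common_maximizer e0 Pp Pz _ (pmax _ Fb) (pmax _ Fe) => x /aPy; rewrite az.
by rewrite subr_ge0; exact: pmax.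
Qed.

(** The cone of functionals that are nonpositive on the edge directions at
    [w k] is the normal cone of the vertex [w k]. *)
Lemma refines_compatible (K : finType) Q w B P : @smooth_model R n K Q w B ->
  refines (normal_fan Q) (normal_fan P) -> forall k, compatible P (B k).
Proof.
move=> mQ rQP k; have sk := model_vertex mQ k.
have [|_ [F [[a [c [_ FE]]] [p Fp]] <-] QF] := rQP (normal_cone Q [set w k]).
  exists [set w k] => //; split; [exact: smooth_vertex_is_vertex sk|by exists (w k)].
exists p => [|x Px i]; first by move: Fp; rewrite FE => -[].
have := QF (- intcovec (facet_normal (B k) i)) _ p x Fp Px.
rewrite pairingNl -pairingNr opprB; apply => _ q -> Qq.
by rewrite pairingNl -pairingNr opprB; case: sk => _ _ /(_ q Qq i).
Qed.

(** Every cone of a coarser normal fan is a union of cones of the finer one,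
    of which there are finitely many. *)
Lemma finite_coarsenings N : polytopal N ->
  finite_set [set normal_fan P | P in [set P : set 'rV[R]_n |
    is_polytope P /\ refines N (normal_fan P)]].
Proof.
move=> [Q pQ ->]; have [k [v QE]] := pQ.
have Qv i : Q (v i) by rewrite QE; exact: conv_hull_gen.
pose cone (J : {set 'I_k.+1}) : set 'cV[R]_n :=
  [set b | forall i j, i \in J -> 0 <= pairing b (v i - v j)].
have coneE F : is_face Q F -> exists J, normal_cone Q F = cone J.
  move=> [a [c [ac FE]]]; exists [set i | `[< F (v i) >]]%SET.
  apply/seteqP; split=> [b Fb i j|b bJ p q Fp].
    by rewrite inE => /asboolP Fi; exact: Fb.
  rewrite pairingBr subr_ge0 QE; apply: pairing_conv_hull_le => j.
  move: Fp; rewrite FE {1}QE => -[[t [t0 t1] tp] /= ap].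
  rewrite -subr_ge0 -pairingBr -tp -[v j]scale1r -t1 scaler_suml -sumrB pairing_sumr.
  apply: sumr_ge0 => i _; rewrite -scalerBr pairingZr.
  have [->|ti] := eqVneq (t i) 0; first by rewrite mul0r.
  rewrite mulr_ge0// bJ// inE; apply/asboolP; rewrite FE; split=> //=.
  have /eqP : \sum_l t l * (c - pairing a (v l)) = 0.
    under eq_bigr do rewrite mulrBr.
    rewrite sumrB -mulr_suml t1 mul1r -ap -tp pairing_sumr.
    by under [X in X - _]eq_bigr do rewrite pairingZr; rewrite subrr.
  rewrite psumr_eq0 => [/allP h|l _]; last by rewrite mulr_ge0// subr_ge0 ac.
  have /implyP/(_ isT) := h i (mem_index_enum i).
  by rewrite mulf_eq0 (negPf ti) subr_eq0 => /eqP.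
pose fan (S : {set {set {set 'I_k.+1}}}) : set (set 'cV[R]_n) :=
  [set \bigcup_(J in [set J | J \in s]) cone J | s in [set s | s \in S]].
apply: (@sub_finite_set _ _ (range fan)); last exact/finite_image/finite_finset.
move=> _ [P [pP rQP] <-].
pose S C : {set {set 'I_k.+1}} := [set J | `[< cone J `<=` C >]]%SET.
have SE C : normal_fan P C -> C = \bigcup_(J in [set J | J \in S C]) cone J.
  move=> [F [[a [m [aF FE]]] [x Fx]] FC]; apply/seteqP; split; last first.
    by move=> b [J /=]; rewrite inE => /asboolP; apply.
  move=> c Cc; have [p Qp cp] := polytope_max c pQ.
  pose G := Q `&` [set x | pairing c x = pairing c p].
  have fG : is_face Q G by exists c, (pairing c p).
  have [J JE] := coneE _ fG.
  have Gc : normal_cone Q G c by move=> g q [_ /= cg] Qq; rewrite pairingBr cg subr_ge0 cp.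
  exists J; last by rewrite -JE.
  rewrite /= inE; apply/asboolP; rewrite -JE -FC => b Gb z q Fz Pq.
  have [|_ [F' [[a' [m' [_ F'E]]] [y F'y]] <-] GF'] := rQP (normal_cone Q G).
    by exists G => //; split=> //; exists p.
  have [e e0 Ge] := normal_cone_interior pQ Qp cp Gb.
  have Py : P y by move: F'y; rewrite F'E => -[].
  have ymax d : normal_cone Q G d -> forall x, P x -> pairing d x <= pairing d y.
    by move=> /GF' dF' x' Px'; rewrite -subr_ge0 -pairingBr; exact: dF'.
  have Pz : P z by move: Fz; rewrite FE => -[].
  rewrite pairingBr (@common_maximizer P c b e y z e0)//; [|move=> x' Px'|exact: ymax..].
    by rewrite subr_ge0; exact: ymax Gb _ Pq.
  by rewrite -subr_ge0 -pairingBr; move: Cc; rewrite -FC; apply.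
exists [set s | `[< exists2 C, normal_fan P C & s = S C >]]%SET => //.
apply/seteqP; split=> [_ [s /= + <-]|C PC].
  by rewrite inE => /asboolP[C PC ->]; rewrite -SE.
exists (S C); last by rewrite -SE.
by rewrite /= inE; apply/asboolP; exists C.
Qed.

End NormalFans.

(** * Smallest enclosing balls and convergence of support functions *)

Section EnclosingBalls.
Context {R : realType} {n : nat}.
Implicit Types (P Q : set 'rV[R]_n) (a : 'cV[R]_n) (x c : 'rV[R]_n) (r : R).

Lemma enorm_ge0 x : 0 <= enorm x.
Proof. exact: sqrtr_ge0. Qed.

Lemma sqr_enorm x : enorm x ^+ 2 = \sum_i x 0 i ^+ 2.
Proof. by rewrite sqr_sqrtr// sumr_ge0// => i _; exact: sqr_ge0. Qed.

Lemma sqr_enormE x : enorm x ^+ 2 = pairing x^T x.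
Proof.
by rewrite sqr_enorm pairingE; apply: eq_bigr => i _; rewrite mxE expr2.
Qed.

Lemma enorm_eq0 x : (enorm x == 0) = (x == 0).
Proof. by rewrite -sqrf_eq0 sqr_enormE pairing_tr_eq0. Qed.

Lemma enormZ (t : R) x : 0 <= t -> enorm (t *: x) = t * enorm x.
Proof.
move=> t0; apply/eqP; rewrite -(eqrXn2 (n := 2))// ?mulr_ge0 ?enorm_ge0//.
rewrite exprMn !sqr_enorm mulr_sumr; apply/eqP.
by apply: eq_bigr => i _; rewrite mxE exprMn.
Qed.

Lemma coord_le_enorm x i : `|x 0 i| <= enorm x.
Proof.
rewrite -(ler_pXn2r (n := 2)) ?nnegrE ?enorm_ge0//.
rewrite real_normK ?num_real// sqr_enorm (bigD1 i)//= lerDl.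
by apply: sumr_ge0 => j _; exact: sqr_ge0.
Qed.

Lemma pairing_le_enorm a x : pairing a x <= enorm a^T * enorm x.
Proof.
have [->|x0] := eqVneq x 0; first by rewrite pairing0r mulr_ge0 ?enorm_ge0.
have nx : 0 < enorm x by rewrite lt_neqAle eq_sym enorm_eq0 x0 enorm_ge0.
have [a0|a0] := eqVneq a^T 0.
  by rewrite -[a]trmxK a0 trmx0 pairing0l mulr_ge0 ?enorm_ge0.
have na : 0 < enorm a^T by rewrite lt_neqAle eq_sym enorm_eq0 a0 enorm_ge0.
have := pairing_tr_ge0 (enorm a^T *: x - enorm x *: a^T).
have -> : (enorm a^T *: x - enorm x *: a^T)^T = enorm a^T *: x^T - enorm x *: a.
  by apply/colP => i; rewrite !mxE.
rewrite pairingBl !pairingBr !pairingZl !pairingZr.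
have -> : pairing x^T a^T = pairing a x.
  by rewrite !pairingE; apply: eq_bigr => i _; rewrite !mxE mulrC.
have -> : pairing a a^T = enorm a^T ^+ 2 by rewrite sqr_enormE trmxK.
rewrite -sqr_enormE => h.
have : 0 <= (enorm x * enorm a^T) * (enorm a^T * enorm x - pairing a x) by lra.
by rewrite pmulr_rge0 ?mulr_gt0// subr_ge0.
Qed.

Lemma encloses_support P c r a x : ball_encloses P (c, r) -> P x ->
  pairing a x <= pairing a c + enorm a^T * r.
Proof.
move=> Pcr Px; rewrite -lerBlDl -pairingBr; apply: le_trans (pairing_le_enorm _ _) _.
by rewrite ler_wpM2l ?enorm_ge0//; exact: Pcr.
Qed.

(** The functional dual to [x - c] measures the distance of [x] to [c]. *)
Lemma support_encloses P c r : 0 <= r ->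
  (forall a x, P x -> pairing a x <= pairing a c + enorm a^T * r) ->
  ball_encloses P (c, r).
Proof.
move=> r0 Pr x Px /=; have [->|xc] := eqVneq (x - c) 0.
  by rewrite (eqP (_ : enorm 0 == 0))// enorm_eq0.
have nx : 0 < enorm (x - c) by rewrite lt_neqAle eq_sym enorm_eq0 xc enorm_ge0.
rewrite -(ler_pM2l nx) -expr2 sqr_enormE pairingBr lerBlDl.
by have := Pr (x - c)^T x Px; rewrite trmxK.
Qed.

Lemma encloses_radius_ge0 P c r : is_polytope P -> ball_encloses P (c, r) -> 0 <= r.
Proof. by move=> /polytope_nonempty[x Px] /(_ x Px); exact: le_trans (enorm_ge0 _). Qed.

Lemma encloses_perturbation P Q (d : R) c r : is_polytope P -> is_polytope Q -> 0 <= d ->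
  (forall a, support_fun P a <= support_fun Q a + d * enorm a^T) ->
  ball_encloses Q (c, r) -> ball_encloses P (c, r + d).
Proof.
move=> pP pQ d0 PQ Qcr; apply: support_encloses => [|a x Px].
  by rewrite addr_ge0// (encloses_radius_ge0 pQ Qcr).
apply: le_trans (pairing_le_support a pP Px) _; apply: le_trans (PQ a) _.
have [q [Qq -> _]] := support_fun_max a pQ.
by rewrite mulrDr addrA [d * _]mulrC lerD2r; exact: encloses_support Qcr Qq.
Qed.

Lemma continuous_bigmax (T : topologicalType) (I : Type) (s : seq I) (f : I -> T -> R) :
  (forall i, continuous (f i)) -> continuous (fun z => \big[Num.max/0]_(i <- s) f i z).
Proof.
move=> cf; elim: s => [|i s IH] x.
  by under eq_fun do rewrite big_nil; exact: cvg_cst.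
under eq_fun do rewrite big_cons.
by apply: (@continuous_max _ _ (f i) _ x); [exact: cf|exact: IH].
Qed.

Lemma cvg_sumr (T I : Type) (F : set_system T) {FF : Filter F} (s : seq I)
    (f : I -> T -> R) (l : I -> R) : (forall i, f i z @[z --> F] --> l i) ->
  (\sum_(i <- s) f i z) @[z --> F] --> \sum_(i <- s) l i.
Proof.
move=> fl; elim: s => [|i s IH].
  by under eq_fun do rewrite big_nil; rewrite big_nil; exact: cvg_cst.
under eq_fun do rewrite big_cons; rewrite big_cons.
by apply: cvgD; [exact: fl|exact: IH].
Qed.

(** The function [rho] is the square of the smallest radius of an enclosing ball
    with given center.  Outside the compact box [K] around a point of [P] it
    exceeds its value at that point. *)
Lemma min_ball_exists P : is_polytope P ->
  exists b : 'rV[R]_n * R,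
    ball_encloses P b /\ forall b', ball_encloses P b' -> b.2 <= b'.2.
Proof.
move=> pP; have [k [v PE]] := pP.
have Pv i : P (v i) by rewrite PE; exact: conv_hull_gen.
pose rho (c : 'rV[R]_n) := \big[Num.max/0]_(j < k.+1) \sum_i (v j 0 i - c 0 i) ^+ 2.
have rho_ge j c : enorm (v j - c) ^+ 2 <= rho c.
  rewrite sqr_enorm /rho (eq_bigr (fun i => (v j 0 i - c 0 i) ^+ 2)) => [|i _].
    exact: (@le_bigmax _ _ _ _ (fun j => \sum_i (v j 0 i - c 0 i) ^+ 2)).
  by rewrite !mxE.
have rho_ge0 c : 0 <= rho c by apply: le_trans (rho_ge ord0 c); exact: sqr_ge0.
have rho_encl c r : ball_encloses P (c, r) -> rho c <= r ^+ 2.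
  move=> Pcr; have r0 := encloses_radius_ge0 pP Pcr.
  apply: bigmax_le => [|j _]; first exact: sqr_ge0.
  have := Pcr _ (Pv j); rewrite -(ler_pXn2r (n := 2)) ?nnegrE ?enorm_ge0// sqr_enorm.
  by under eq_bigr do rewrite !mxE.
have encl_rho c : ball_encloses P (c, Num.sqrt (rho c)).
  apply: support_encloses => [|a x]; first exact: sqrtr_ge0.
  rewrite PE; apply: pairing_conv_hull_le => j; rewrite -lerBlDl -pairingBr.
  apply: le_trans (pairing_le_enorm _ _) _; rewrite ler_wpM2l ?enorm_ge0//.
  by rewrite -(ler_pXn2r (n := 2)) ?nnegrE ?enorm_ge0 ?sqrtr_ge0// [leRHS]sqr_sqrtr//.
pose M := Num.sqrt (rho (v ord0)).
pose K : set 'rV[R]_n := [set c | forall i, `[v ord0 0 i - M, v ord0 0 i + M]%classic (c 0 i)].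
have M0 : 0 <= M by exact: sqrtr_ge0.
have K0 : K (v ord0).
  by move=> i; rewrite /= in_itv /= gerBl lerDl M0.
have cK : compact K.
  by apply: (@rV_compact R n (fun i => `[v ord0 0 i - M, v ord0 0 i + M]%classic)) => i;
    exact: segment_compact.
have crho : continuous rho.
  apply: continuous_bigmax => j c.
  apply: (@cvg_sumr _ _ _ (nbhs_filter c) _ (fun i z => (v j 0 i - z 0 i) ^+ 2)) => i.
  have h : (v j 0 i - z 0 i) @[z --> c] --> v j 0 i - c 0 i.
    by apply: cvgB; [exact: cvg_cst|exact: coord_continuous].
  exact: (cvgM h h).
have [|c /set_mem Kc cmin] := @EVT_min_rV R n rho K _ cK (continuous_subspaceT crho).
  by exists (v ord0).
exists (c, Num.sqrt (rho c)); split; first exact: encl_rho.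
move=> [c' r] Pcr /=; have r0 := encloses_radius_ge0 pP Pcr.
rewrite -(ler_pXn2r (n := 2)) ?nnegrE ?sqrtr_ge0// sqr_sqrtr//.
apply: le_trans (rho_encl _ _ Pcr).
have [Kc'|] := pselect (K c'); first by apply: cmin; exact: mem_set.
move=> /existsNP[i]; rewrite /= in_itv /= => /negP ci.
apply: le_trans (cmin _ (mem_set K0)) _; rewrite leNgt; apply/negP => lt.
move/negP: ci; apply; rewrite -ler_distlC.
have := coord_le_enorm (v ord0 - c') i; rewrite !mxE => /le_trans; apply.
rewrite -(ler_pXn2r (n := 2)) ?nnegrE ?enorm_ge0// [leRHS]sqr_sqrtr//.
exact: le_trans (rho_ge _ _) (ltW lt).
Qed.

Lemma min_ballP P : is_polytope P -> ball_encloses P (ball_center P, ball_radius P) /\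
  forall c r, ball_encloses P (c, r) -> ball_radius P <= r.
Proof.
move=> pP; have [mP mmin] : [set b | ball_encloses P b /\
    forall b', ball_encloses P b' -> b.2 <= b'.2] (min_ball P).
  by apply: xgetPex; exact: min_ball_exists.
split; first by rewrite /ball_center /ball_radius -surjective_pairing.
by move=> c r /mmin.
Qed.

Lemma ball_radius_ge0 P : is_polytope P -> 0 <= ball_radius P.
Proof. by move=> pP; have [/(encloses_radius_ge0 pP)] := min_ballP pP. Qed.

(** The ball around the midpoint of two centers is smaller than the two balls
    by an amount controlled by the distance of the centers. *)
Lemma dist_center_le P c r : is_polytope P -> ball_encloses P (c, r) ->
  enorm (c - ball_center P) ^+ 2 <= 4 * (r ^+ 2 - ball_radius P ^+ 2).
Proof.
move=> pP Pcr; have [P0 rmin] := min_ballP pP.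
have r0 := encloses_radius_ge0 pP Pcr; have rho0 := ball_radius_ge0 pP.
set c0 := ball_center P in P0 *; set rho := ball_radius P in P0 rho0 rmin *.
have rhor : rho <= r := rmin _ _ Pcr.
pose m := 2^-1 *: (c + c0).
have mid x : P x -> enorm (x - m) ^+ 2 <= r ^+ 2 - enorm (c - c0) ^+ 2 / 4.
  move=> Px.
  have -> : enorm (x - m) ^+ 2 =
      (enorm (x - c) ^+ 2 + enorm (x - c0) ^+ 2) / 2 - enorm (c - c0) ^+ 2 / 4.
    rewrite !sqr_enorm -big_split mulr_suml mulr_suml -sumrB.
    by apply: eq_bigr => i _; rewrite !mxE /=; field.
  rewrite lerD2r; have h1 : enorm (x - c) ^+ 2 <= r ^+ 2.
    by rewrite ler_pXn2r ?nnegrE ?enorm_ge0//; exact: Pcr.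
  have h2 : enorm (x - c0) ^+ 2 <= r ^+ 2.
    by rewrite ler_pXn2r ?nnegrE ?enorm_ge0//; apply: le_trans rhor; exact: P0.
  lra.
have [x0 Px0] := polytope_nonempty pP.
have s0 : 0 <= r ^+ 2 - enorm (c - c0) ^+ 2 / 4.
  by apply: le_trans (mid _ Px0); exact: sqr_ge0.
have : rho <= Num.sqrt (r ^+ 2 - enorm (c - c0) ^+ 2 / 4).
  apply: (rmin m) => x Px /=.
  by rewrite -(ler_pXn2r (n := 2)) ?nnegrE ?enorm_ge0 ?sqrtr_ge0// [leRHS]sqr_sqrtr//; exact: mid.
rewrite -(ler_pXn2r (n := 2)) ?nnegrE ?sqrtr_ge0// sqr_sqrtr//; lra.
Qed.

Lemma min_ball_unique P c : is_polytope P -> ball_encloses P (c, ball_radius P) ->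
  c = ball_center P.
Proof.
move=> pP /(dist_center_le pP); rewrite subrr mulr0 => h; apply/eqP.
by rewrite -subr_eq0 -enorm_eq0 -sqrf_eq0 eq_le h sqr_ge0.
Qed.

Lemma ball_radius_gt0 P : is_polytope P -> ~ is_point P -> 0 < ball_radius P.
Proof.
move=> pP nP; rewrite lt_neqAle ball_radius_ge0// andbT eq_sym; apply/eqP => r0.
have [Pb _] := min_ballP pP; apply: nP.
have Pc x : P x -> x = ball_center P.
  move=> /Pb /=; rewrite r0 => xc; apply/eqP.
  by rewrite -subr_eq0 -enorm_eq0 eq_le xc enorm_ge0.
exists (ball_center P); apply/seteqP; split=> [x /Pc //|_ ->].
by have [x Px] := polytope_nonempty pP; rewrite -(Pc x Px).
Qed.

Lemma min_ball_homothety P Q (t : R) v : is_polytope P -> is_polytope Q -> 0 < t ->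
  Q = [set t *: x + v | x in P] ->
  ball_center Q = t *: ball_center P + v /\ ball_radius Q = t * ball_radius P.
Proof.
move=> pP pQ t0 QE; have [bP mP] := min_ballP pP; have [bQ mQ] := min_ballP pQ.
have PQ c r : ball_encloses P (c, r) -> ball_encloses Q (t *: c + v, t * r).
  move=> Pcr y; rewrite QE => -[x Px <-] /=.
  rewrite opprD addrACA subrr addr0 -scalerBr enormZ ?(ltW t0)// ler_pM2l//.
  exact: Pcr.
have QP c r : ball_encloses Q (c, r) -> ball_encloses P (t^-1 *: (c - v), t^-1 * r).
  move=> Qcr x Px /=; have Qx : Q (t *: x + v) by rewrite QE; exists x.
  have -> : x - t^-1 *: (c - v) = t^-1 *: (t *: x + v - c).
    by apply/rowP => i; rewrite !mxE; field; exact: lt0r_neq0.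
  by rewrite enormZ ?invr_ge0 ?(ltW t0)// ler_pM2l ?invr_gt0//; exact: Qcr.
have rE : ball_radius Q = t * ball_radius P.
  apply/eqP; rewrite eq_le (mQ _ _ (PQ _ _ bP))/=.
  by have := mP _ _ (QP _ _ bQ); rewrite -(ler_pM2l t0) mulrA mulfV ?mul1r ?gt_eqF.
by split=> //; apply/esym/min_ball_unique => //; rewrite rE; exact: PQ.
Qed.

End EnclosingBalls.

Section SupportConvergence.
Context {R : realType} {n : nat}.
Implicit Types (P : set 'rV[R]_n) (a b : 'cV[R]_n).

Lemma support_fun_subadditive P a b : is_polytope P ->
  support_fun P (a + b) <= support_fun P a + support_fun P b.
Proof.
move=> pP; have [p [Pp -> _]] := support_fun_max (a + b) pP.
by rewrite pairingDl lerD//; exact: pairing_le_support.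
Qed.

Lemma support_funZ P (t : R) a : is_polytope P -> 0 <= t ->
  support_fun P (t *: a) = t * support_fun P a.
Proof.
move=> pP t0; have [p [Pp -> pm]] := support_fun_max a pP.
rewrite (support_funE Pp) ?pairingZl// => x Px.
by rewrite !pairingZl ler_wpM2l// pm.
Qed.

Lemma support_fun_lipschitz P (M : R) a : is_polytope P ->
  (forall i, support_fun P (delta_mx i 0) <= M) ->
  (forall i, support_fun P (- delta_mx i 0) <= M) ->
  support_fun P a <= M * \sum_i `|a i 0|.
Proof.
move=> pP M1 M2; have [p [Pp -> _]] := support_fun_max a pP.
have pd i : pairing (delta_mx i 0) p = p 0 i.
  rewrite pairingE (bigD1 i)//= mxE !eqxx mulr1 big1 ?addr0// => j ji.
  by rewrite mxE (negPf ji) mulr0.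
have pM i : `|p 0 i| <= M.
  rewrite ler_norml lerNl -pd -pairingNl.
  by rewrite !(le_trans (pairing_le_support _ pP Pp)).
rewrite pairingE mulr_sumr; apply: ler_sum => i _.
by apply: le_trans (ler_norm _) _; rewrite normrM ler_wpM2r.
Qed.

Context {T : Type} {F : set_system T} {FF : Filter F}.
Context (P : T -> set 'rV[R]_n) (P0 : set 'rV[R]_n).
Hypotheses (pP : forall y, is_polytope (P y)) (pP0 : is_polytope P0).
Hypothesis supp_cvg : forall a, support_fun (P y) a @[y --> F] --> support_fun P0 a.

(** Pointwise convergence is uniform on compact sets: the coordinates of the
    points of [P y] are eventually bounded by some [M], so that the support
    functions are eventually Lipschitz with the same constant. *)
Lemma support_fun_cvg_uniform (e : R) : 0 < e ->
  \forall y \near F, forall a, `|support_fun (P y) a - support_fun P0 a| <= e * enorm a^T.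
Proof.
move=> e0; pose K : set 'rV[R]_n := [set x | forall i, `[-1, 1]%classic (x 0 i)].
have cK : compact K.
  by apply: (@rV_compact R n (fun=> `[-1, 1]%classic)) => i; exact: segment_compact.
have [M [M0 M0P MP]] : exists M : R, [/\ 0 < M,
    (forall i, support_fun P0 (delta_mx i 0) <= M /\ support_fun P0 (- delta_mx i 0) <= M) &
    \forall y \near F, forall i, support_fun (P y) (delta_mx i 0) <= M /\
                                 support_fun (P y) (- delta_mx i 0) <= M].
  pose M := 1 + \sum_i (`|support_fun P0 (delta_mx i 0)| + `|support_fun P0 (- delta_mx i 0)|).
  have Mi i : support_fun P0 (delta_mx i 0) <= M - 1 /\
              support_fun P0 (- delta_mx i 0) <= M - 1.
    rewrite /M addrAC subrr add0r (bigD1 i)//=.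
    have : 0 <= \sum_(j < n | j != i)
        (`|support_fun P0 (delta_mx j 0)| + `|support_fun P0 (- delta_mx j 0)|).
      by apply: sumr_ge0 => j _; rewrite addr_ge0.
    have := ler_norm (support_fun P0 (delta_mx i 0)).
    have := ler_norm (support_fun P0 (- delta_mx i 0)).
    have := normr_ge0 (support_fun P0 (delta_mx i 0)).
    have := normr_ge0 (support_fun P0 (- delta_mx i 0)).
    by split; lra.
  exists M; split.
  - by rewrite /M ltr_pwDl// sumr_ge0// => i _; rewrite addr_ge0.
  - by move=> i; have [] := Mi i; split; lra.
  - apply: filter_forall => i; have [h1 h2] := Mi i.
    have /cvgrPdist_le/(_ 1 ltr01) c1 := @supp_cvg (delta_mx i 0).
    have /cvgrPdist_le/(_ 1 ltr01) c2 := @supp_cvg (- delta_mx i 0).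
    by near=> y; split; [have : `|support_fun P0 (delta_mx i 0) -
        support_fun (P y) (delta_mx i 0)| <= 1 by near: y|
      have : `|support_fun P0 (- delta_mx i 0) -
        support_fun (P y) (- delta_mx i 0)| <= 1 by near: y];
      rewrite ler_norml => /andP[]; lra.
have lip (Q : set 'rV[R]_n) (x x' : 'rV[R]_n) : is_polytope Q -> (forall i, support_fun Q (delta_mx i 0) <= M /\
    support_fun Q (- delta_mx i 0) <= M) ->
    support_fun Q x^T - support_fun Q x'^T <= M * \sum_i `|x 0 i - x' 0 i|.
  move=> pQ QM; rewrite lerBlDl.
  have := support_fun_subadditive x'^T (x - x')^T pQ.
  rewrite -linearD /= subrKC => /le_trans; apply; rewrite lerD2l.
  have [Q1 Q2] : (forall i, support_fun Q (delta_mx i 0) <= M) /\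
    (forall i, support_fun Q (- delta_mx i 0) <= M) by split=> i; case: (QM i).
  apply: le_trans (support_fun_lipschitz _ pQ Q1 Q2) _.
  by rewrite ler_pM2l//; apply: ler_sum => i _; rewrite !mxE.
have : \near F, K `<=` (fun y x => `|support_fun (P y) x^T - support_fun P0 x^T| <= e) F.
  move/compact_near_coveringP: cK; apply => x _.
  pose d := e / (4 * M * n.+1%:R).
  have d0 : 0 < d by rewrite divr_gt0// !mulr_gt0// ltr0n.
  have /cvgrPdist_le/(_ (e / 2)) cx := @supp_cvg x^T.
  have ball_d : \forall x' \near x, forall i, `|x 0 i - (x' : 'rV[R]_n) 0 i| <= d.
    apply/nbhs_ballP; exists d => //= x' [_ xx'] i; exact/ltW/(xx' 0 i).
  near=> x' y => /=.
  have h1 : forall i, `|x 0 i - x' 0 i| <= d by near: x'.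
  have h2 : `|support_fun P0 x^T - support_fun (P y) x^T| <= e / 2.
    by near: y; apply: cx; rewrite divr_gt0.
  have h3 : forall i, support_fun (P y) (delta_mx i 0) <= M /\
                      support_fun (P y) (- delta_mx i 0) <= M by near: y.
  have hs : M * \sum_i `|x 0 i - x' 0 i| <= e / 4.
    have : \sum_i `|x 0 i - x' 0 i| <= n.+1%:R * d.
      apply: le_trans (_ : _ <= \sum_(i < n) d) _; first by apply: ler_sum => i _; exact: h1.
      by rewrite sumr_const card_ord -[leLHS]mulr_natl ler_wpM2r ?ler_nat ?(ltW d0).
    rewrite -(ler_pM2l M0) => /le_trans; apply; rewrite /d.
    have : (n.+1%:R : R) != 0 by rewrite pnatr_eq0.
    move: (n.+1%:R : R) => N N0.
    have -> // : M * (N * (e / (4 * M * N))) = e / 4.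
    by field; rewrite N0 lt0r_neq0.
  have hs' : M * \sum_i `|x' 0 i - x 0 i| <= e / 4.
    by under eq_bigr do rewrite distrC.
  have := lip _ x x' (pP y) h3; have := lip _ x' x (pP y) h3.
  have := lip _ x x' pP0 M0P; have := lip _ x' x pP0 M0P.
  move: h2; rewrite !ler_norml => /andP[? ?] ? ? ? ?; apply/andP; split; lra.
apply: filterS => y Ky a.
have [a0|a0] := eqVneq (enorm a^T) 0.
  have /eqP := a0; rewrite enorm_eq0 => /eqP aT0.
  have -> : a = 0 *: a by rewrite -[a]trmxK aT0 trmx0 scaler0.
  by rewrite !support_funZ// !mul0r subrr normr0 mulr_ge0 ?enorm_ge0 ?ltW.
have na : 0 < enorm a^T by rewrite lt_neqAle eq_sym a0 enorm_ge0.
have aE : a = enorm a^T *: ((enorm a^T)^-1 *: a^T)^T.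
  by rewrite linearZ /= trmxK scalerA mulfV// scale1r.
rewrite {1 2}aE !support_funZ ?(ltW na)// -mulrBr normrM (gtr0_norm na) mulrC.
rewrite ler_pM2r//; apply: Ky => i; rewrite /= in_itv /= -ler_norml mxE normrM.
by rewrite normfV (gtr0_norm na) mulrC ler_pdivrMr ?mul1r//; exact: coord_le_enorm.
Unshelve. all: by end_near. Qed.

Lemma near_encloses (e : R) : 0 < e -> \forall y \near F,
  (forall c r, ball_encloses P0 (c, r) -> ball_encloses (P y) (c, r + e)) /\
  (forall c r, ball_encloses (P y) (c, r) -> ball_encloses P0 (c, r + e)).
Proof.
move=> e0; have := support_fun_cvg_uniform e0; apply: filterS => y Py.
by split=> c r; apply: encloses_perturbation => //; try exact: ltW;
  move=> a; have := Py a; rewrite ler_norml => /andP[]; lra.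
Qed.

Lemma ball_radius_cvg : ball_radius (P y) @[y --> F] --> ball_radius P0.
Proof.
apply/cvgrPdist_le => e e0; have := near_encloses e0; apply: filterS => y [h1 h2].
have [b0 m0] := min_ballP pP0; have [by_ my] := min_ballP (pP y).
have := my _ _ (h1 _ _ b0); have := m0 _ _ (h2 _ _ by_).
by rewrite ler_norml => ? ?; apply/andP; split; lra.
Qed.

Lemma ball_center_cvg : ball_center (P y) @[y --> F] --> ball_center P0.
Proof.
apply/cvgrPdist_le => e e0; set rho := ball_radius P0.
have rho0 : 0 <= rho by exact: ball_radius_ge0.
pose d := Num.min 1 (e ^+ 2 / (16 * (rho + 1))).
have d0 : 0 < d.
  by rewrite lt_min ltr01 divr_gt0 ?exprn_gt0// mulr_gt0// ltr_wpDl.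
have := near_encloses d0; apply: filterS => y [h1 h2].
have [b0 m0] := min_ballP pP0; have [by_ my] := min_ballP (pP y).
have ry : ball_radius (P y) <= rho + d := my _ _ (h1 _ _ b0).
have := dist_center_le pP0 (h2 _ _ by_); rewrite -/rho => hc.
have : enorm (ball_center (P y) - ball_center P0) ^+ 2 <= e ^+ 2.
  apply: le_trans hc _.
  have d1 : d <= 1 by rewrite ge_min lexx.
  have d2 : d * (16 * (rho + 1)) <= e ^+ 2.
    by rewrite -ler_pdivlMr ?mulr_gt0 ?ltr_wpDl// ge_min lexx orbT.
  have ry0 := ball_radius_ge0 (pP y).
  have : (ball_radius (P y) + d) ^+ 2 <= (rho + d + d) ^+ 2.
    by rewrite ler_pXn2r ?nnegrE ?lerD2r ?addr_ge0 ?(ltW d0).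
  nra.
rewrite ler_pXn2r ?nnegrE ?enorm_ge0 ?(ltW e0)// => ce.
rewrite -opprB normrN; apply: le_trans _ ce.
rewrite /Num.norm /= mx_normrE; apply: bigmax_le => [|[i j] _ /=]; first exact: enorm_ge0.
by rewrite ord1; exact: coord_le_enorm.
Qed.

End SupportConvergence.

(** * The CW topology *)

Section Homotheties.
Context {R : realType} {n : nat}.
Implicit Types (P Q : set 'rV[R]_n) (a : 'cV[R]_n) (v : 'rV[R]_n) (t : R).

Lemma homothety_polytope P t v : is_polytope P -> is_polytope [set t *: x + v | x in P].
Proof.
move=> [k [g ->]]; exists k, (fun i => t *: g i + v).
have E c : \sum_i c i = 1 -> \sum_i c i *: (t *: g i + v) = t *: (\sum_i c i *: g i) + v.
  move=> c1; under eq_bigr do rewrite scalerDr scalerA mulrC -scalerA.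
  by rewrite big_split /= -scaler_sumr -scaler_suml c1 scale1r.
apply/seteqP; split=> [_ [_ [c [c0 c1] <-] <-]|_ [c [c0 c1] <-]].
  by exists c => //; exact: E.
by exists (\sum_i c i *: g i); [exists c|rewrite E].
Qed.

Lemma support_fun_homothety P t v a : is_polytope P -> 0 < t ->
  support_fun [set t *: x + v | x in P] a = t * support_fun P a + pairing a v.
Proof.
move=> pP t0; have [p [Pp -> pm]] := support_fun_max a pP.
rewrite (support_funE (p := t *: p + v)) ?pairingDr ?pairingZr//; first by exists p.
by move=> _ [x Px <-]; rewrite !pairingDr !pairingZr lerD2r ler_pM2l// pm.
Qed.

Lemma normal_fan_homothety P Q : homothetic P Q -> normal_fan P = normal_fan Q.
Proof.
suff sub P1 P2 : homothetic P1 P2 -> normal_fan P1 `<=` normal_fan P2.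
  by move=> PQ; apply/seteqP; split; apply: sub => //; exact: homothetic_sym.
move=> [t [v [t0 ->]]] _ [F [[a [c [aP FE]]] [p Fp]] <-].
have E b x y : pairing b (t *: x + v - (t *: y + v)) = t * pairing b (x - y).
  by rewrite opprD addrACA subrr addr0 -scalerBr pairingZr.
exists [set t *: x + v | x in F].
  split; last by exists (t *: p + v); exists p.
  exists a, (t * c + pairing a v); split.
    by move=> _ [x Px <-]; rewrite pairingDr pairingZr lerD2r ler_pM2l// aP.
  rewrite FE; apply/seteqP; split=> [_ [x [Px /= <-] <-]|_ [[x Px <-] /=]].
    by split; [exists x|rewrite /= pairingDr pairingZr].
  rewrite pairingDr pairingZr => /addIr /(mulfI (lt0r_neq0 t0)) ax.
  by exists x.
apply/seteqP; split=> b bF.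
  move=> x y Fx Py; rewrite -(pmulr_rge0 _ t0) -E.
  by apply: bF; [exists x|exists y].
by move=> _ _ [x Fx <-] [y Py <-]; rewrite E pmulr_rge0//; exact: bF.
Qed.

Lemma pairing_cvg a (T : Type) (F : set_system T) {FF : Filter F}
    (u : T -> 'rV[R]_n) (l : 'rV[R]_n) :
  u y @[y --> F] --> l -> pairing a (u y) @[y --> F] --> pairing a l.
Proof.
move=> ul; rewrite pairingE; under eq_fun do rewrite pairingE.
apply: cvg_sumr => i; apply: cvgM; last exact: cvg_cst.
apply: (@cvg_comp _ _ _ u (fun z : 'rV[R]_n => z 0 i) _ _ _ ul).
exact: coord_continuous.
Qed.

(** The support function of the representative of [P] that is enclosed by the
    unit ball. *)
Definition normalized_support a P : R :=
  (support_fun P a - pairing a (ball_center P)) / ball_radius P.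

Lemma normalized_support_homothety a (P Q : npolytope R n) : homothetic P Q ->
  normalized_support a P = normalized_support a Q.
Proof.
move=> [t [v [t0 QE]]]; have pP := polytopeP P; have pQ := polytopeP Q.
have r0 := ball_radius_gt0 pP (@npolytopeP _ _ P).
rewrite /normalized_support; have [-> ->] := min_ball_homothety pP pQ t0 QE.
rewrite {1}QE support_fun_homothety// pairingDr pairingZr.
by field; rewrite !lt0r_neq0.
Qed.

Lemma normalized_support_inj (P Q : npolytope R n) :
  (forall a, normalized_support a P = normalized_support a Q) -> homothetic P Q.
Proof.
move=> PQ; have pP := polytopeP P; have pQ := polytopeP Q.
have r0 := ball_radius_gt0 pP (@npolytopeP _ _ P).
have s0 := ball_radius_gt0 pQ (@npolytopeP _ _ Q).
pose t := ball_radius Q / ball_radius P.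
have t0 : 0 < t by rewrite divr_gt0.
exists t, (ball_center Q - t *: ball_center P); split=> //.
apply: support_fun_inj => //; first exact: homothety_polytope.
move=> a; rewrite support_fun_homothety// pairingBr pairingZr.
have /eqP := PQ a; rewrite /normalized_support eqr_div ?lt0r_neq0// => /eqP h.
have -> : support_fun Q a = ball_radius Q * ((support_fun P a - pairing a (ball_center P))
    / ball_radius P) + pairing a (ball_center Q).
  by rewrite mulrA [ball_radius Q * _]mulrC h mulfK ?lt0r_neq0// subrK.
by rewrite /t; field; rewrite lt0r_neq0.
Qed.

Lemma normalized_support_cvg a (T : Type) (F : set_system T) {FF : Filter F}
    (P : T -> npolytope R n) (P0 : npolytope R n) :
  (forall b, support_fun (P y) b @[y --> F] --> support_fun P0 b) ->
  normalized_support a (P y) @[y --> F] --> normalized_support a P0.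
Proof.
move=> h; have pP y := polytopeP (P y).
have c := ball_center_cvg (FF := FF) pP (polytopeP P0) h.
have r := ball_radius_cvg (FF := FF) pP (polytopeP P0) h.
have ca : pairing a (ball_center (P y)) @[y --> F] --> pairing a (ball_center P0).
  exact: pairing_cvg.
apply: cvgM; first exact: cvgB.
apply: cvgV => //; apply: lt0r_neq0; exact: (ball_radius_gt0 (polytopeP P0) (@npolytopeP _ _ P0)).
Qed.

End Homotheties.

Section Shapes.
Context {R : realType} {n : nat}.
Implicit Types (P Q : npolytope R n) (a : 'cV[R]_n) (N : set (set 'cV[R]_n)).

Lemma shape_of_eq P Q : shape_of P = shape_of Q <-> homothetic P Q.
Proof. by split=> [/eqmodP/asboolP|h]; last exact/eqmodP/asboolP. Qed.

Definition fan_member N (P : fan_space N) : npolytope R n := set_val (P : fan_polytopes N).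

Lemma fan_support_cvg N (P0 : fan_space N) a :
  support_fun (fan_member P) a @[P --> P0] --> support_fun (fan_member P0) a.
Proof.
have : {ptws, fan_support P @[P --> P0] --> fan_support P0}.
  exact: initial_continuous.
move=> /pointwise_cvgP h; have hF : Filter (fan_support P @[P --> P0]).
  by apply: fmap_filter; exact: nbhs_filter P0.
exact: h hF a.
Qed.

(** A continuous function on the space of shapes, through which the CW topology
    controls the support functions. *)
Definition shape_support a (x : polyshape R n) : R := normalized_support a (repr x).

Lemma shape_supportE a P : shape_support a (shape_of P) = normalized_support a P.
Proof. by apply: normalized_support_homothety; apply/shape_of_eq; rewrite /shape_of reprK. Qed.

Lemma shape_support_continuous a : continuous (shape_support a).
Proof.
apply/continuousP => U Uo; apply/cw_openE => N _ _.
have -> : @fan_shape _ _ N @^-1` (shape_support a @^-1` U) =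
    (fun P : fan_space N => normalized_support a (fan_member P)) @^-1` U.
  by apply/seteqP; split=> P /=; rewrite /fan_shape shape_supportE.
apply: open_comp => // P _; apply: (normalized_support_cvg (FF := nbhs_filter P)) => b.
exact: fan_support_cvg.
Qed.

(** The support function is recovered from the shape, the center and the radius,
    all of which are continuous for the CW topology. *)
Lemma support_fun_cvg a (T : Type) (F : set_system T) {FF : Filter F}
    (P : T -> npolytope_space R n) (P0 : npolytope_space R n) :
  P y @[y --> F] --> P0 -> support_fun (P y) a @[y --> F] --> support_fun P0 a.
Proof.
move=> PP0.
have h : cw_chart (P y) @[y --> F] --> cw_chart P0.
  by apply: (@cvg_comp _ _ _ P (@cw_chart R n) _ _ _ PP0); exact: initial_continuous.
have hs : shape_of (P y) @[y --> F] --> shape_of P0.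
  by apply: (@cvg_comp _ _ _ (fun y => cw_chart (P y)) fst _ _ _ h); exact: cvg_fst.
have hb : (cw_chart (P y)).2 @[y --> F] --> (cw_chart P0).2.
  by apply: (@cvg_comp _ _ _ (fun y => cw_chart (P y)) snd _ _ _ h); exact: cvg_snd.
have hc : ball_center (P y) @[y --> F] --> ball_center P0.
  by apply: (@cvg_comp _ _ _ (fun y => (cw_chart (P y)).2) fst _ _ _ hb); exact: cvg_fst.
have hr : ball_radius (P y) @[y --> F] --> ball_radius P0.
  by apply: (@cvg_comp _ _ _ (fun y => (cw_chart (P y)).2) snd _ _ _ hb); exact: cvg_snd.
have E (Q : npolytope R n) : support_fun Q a =
    ball_radius Q * shape_support a (shape_of Q) + pairing a (ball_center Q).
  rewrite shape_supportE /normalized_support mulrC divfK ?subrK//.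
  exact/lt0r_neq0/(ball_radius_gt0 (polytopeP Q) (@npolytopeP _ _ Q)).
rewrite E; under eq_fun do rewrite E.
apply: cvgD; last exact: pairing_cvg.
apply: cvgM; first exact: hr.
apply: (@cvg_comp _ _ _ (fun y => shape_of (P y)) (shape_support a) _ _ _ hs).
exact: shape_support_continuous.
Qed.

(** A shape is determined by its normalized support function, which depends
    continuously on the polytope. *)
Lemma fan_shape_fiber_closed N (P0 : fan_space N) :
  closed (@fan_shape _ _ N @^-1` [set fan_shape P0]).
Proof.
suff -> : @fan_shape _ _ N @^-1` [set fan_shape P0] =
    \bigcap_a ((fun P : fan_space N => normalized_support a (fan_member P)) @^-1`
               [set normalized_support a (fan_member P0)]).
  apply: closed_bigI => a _; apply: closed_comp; last exact: closed_eq.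
  move=> P _; apply: (normalized_support_cvg (FF := nbhs_filter P)) => b.
  exact: fan_support_cvg.
apply/seteqP; split=> [P /= PP0 a _|P PP0] /=.
  by apply: normalized_support_homothety; apply/shape_of_eq.
by apply/shape_of_eq/normalized_support_inj => a; exact: (PP0 a I).
Qed.

(** A set of shapes with finitely many points in every cell is closed, as
    points are closed in the cells. *)
Lemma locally_finite_closed (X : set (polyshape R n)) :
  (forall N, polytopal N -> finite_set (X `&` cell N)) -> closed X.
Proof.
move=> Xfin; rewrite -[X]setCK; apply: open_closedC; apply/cw_openE => N pN _.
rewrite preimage_setC; apply: closed_openC.
suff XE : @fan_shape _ _ N @^-1` X =
    \bigcup_(x in X `&` cell N) (@fan_shape _ _ N @^-1` [set x]).
  suff : closed (\bigcup_(x in X `&` cell N) (@fan_shape _ _ N @^-1` [set x])).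
    by rewrite -XE.
  apply: closed_bigcup; first exact: Xfin.
  by move=> x [_ [P0 _ <-]]; exact: fan_shape_fiber_closed.
apply/seteqP; split=> [P XP|P [x [Xx _]] /= ->] //.
by exists (fan_shape P) => //; split=> //; exists P.
Qed.

Lemma fan_polytopes_nontrivial N P : fan_polytopes N P -> N <> [set setT].
Proof.
move=> NP NE; have [|_ [F [fF [p Fp]] <-] FT] := NP setT; first by rewrite NE.
have Pp : (P : set 'rV[R]_n) p by case: fF Fp => a [c [_ ->]] [].
apply: (@npolytopeP _ _ P); exists p; apply/seteqP; split=> [q Pq|_ -> //].
apply/eqP; rewrite -subr_eq0 -oppr_eq0 opprB -pairing_tr_eq0 eq_le pairing_tr_ge0 andbT.
by have := FT (- (p - q)^T) I p q Fp Pq; rewrite pairingNl oppr_ge0.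
Qed.

(** Inside a single closed cell the topology is that of pointwise convergence
    of support functions. *)
Lemma npolytope_cvg N (T : Type) (F : set_system T) {FF : Filter F}
    (P : T -> npolytope_space R n) (P0 : npolytope_space R n) : polytopal N ->
  (\forall y \near F, fan_polytopes N (P y)) -> fan_polytopes N P0 ->
  (forall b, support_fun (P y) b @[y --> F] --> support_fun P0 b) ->
  P y @[y --> F] --> P0.
Proof.
move=> pN NP NP0 h.
have hs : shape_of (P y) @[y --> F] --> shape_of P0.
  move=> V; rewrite nbhsE => -[U [Uo UP0] UV].
  have [B Bo BE] := (cw_openE U).1 Uo N pN (fan_polytopes_nontrivial NP0).
  pose elt Q (NQ : fan_polytopes N Q) : fan_space N := exist _ Q (mem_set NQ).
  have BP0 : B (support_fun P0).
    have : (@fan_shape R n N @^-1` U) (elt _ NP0) by [].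
    by rewrite -BE.
  have hB : \forall y \near F, B (support_fun (P y)).
    have hp : {ptws, support_fun (P y) @[y --> F] --> support_fun P0}.
      by apply/pointwise_cvgP => b; exact: h.
    by apply: hp; exact: open_nbhs_nbhs.
  suff : \forall y \near F, V (shape_of (P y)) by [].
  near=> y; apply: UV.
  have By : B (support_fun (P y)) by near: y.
  have NPy : fan_polytopes N (P y) by near: y.
  have : (@fan_support R n N @^-1` B) (elt _ NPy) by [].
  by rewrite BE.
have hc := ball_center_cvg (FF := FF) (fun y => polytopeP (P y)) (polytopeP P0) h.
have hr := ball_radius_cvg (FF := FF) (fun y => polytopeP (P y)) (polytopeP P0) h.
have hch : cw_chart (P y) @[y --> F] --> cw_chart P0.
  exact: (cvg_pair hs (cvg_pair hc hr)).
move=> V; rewrite nbhsE => -[U [[B Bo <-] BP0] UV].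
have : \forall y \near F, B (cw_chart (P y)) by apply: hch; exact: open_nbhs_nbhs.
by apply: filterS => y By; exact: UV.
Unshelve. all: by end_near. Qed.

End Shapes.

(** * Compact families and Minkowski sums *)

Section CompactFamilies.
Context {R : realType} {n : nat}.

(** Otherwise polytopes [P (s i)] with pairwise distinct normal fans would have
    shapes forming an infinite set all of whose subsets are closed, as each cell
    contains finitely many of them; this is impossible near a cluster point of
    the sequence [s]. *)
Lemma finite_normal_fans (T : ptopologicalType) (K : set T) (P : T -> npolytope_space R n) :
  compact K -> (forall p, K p -> P y @[y --> within K (nbhs p)] --> P p) ->
  finite_set [set normal_fan (P y : set 'rV[R]_n) | y in K].
Proof.
move=> cK cP; apply: contrapT => /infiniteP/pcard_leP/unsquash fan.
have /choice[s sP] : forall i, exists y, K y /\ normal_fan (P y : set 'rV[R]_n) = fan i.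
  move=> i; have [y Ky yE] : [set normal_fan (P y : set 'rV[R]_n) | y in K] (fan i).
    exact: (@funS _ _ _ _ fan).
  by exists y.
pose sh y := shape_of (P y).
have sh_inj i j : sh (s i) = sh (s j) -> i = j.
  move=> /shape_of_eq/normal_fan_homothety; rewrite (sP i).2 (sP j).2.
  by apply: (@inj _ _ _ fan); rewrite inE.
have sK : (s @ \oo) K by exists 0%N => // i _; case: (sP i).
have [p [Kp sp]] : K `&` cluster (s @ \oo) !=set0 by apply: cK.
pose X j := [set sh (s i) | i in [set i | (j <= i)%N]].
have Xcl j : closed (X j).
  apply: locally_finite_closed => N pN.
  have : finite_set [set i | fan_polytopes N (P (s i))].
    apply: (@sub_finite_set _ _ (fan @^-1` [set normal_fan P' | P' in
        [set P' : set 'rV[R]_n | is_polytope P' /\ refines N (normal_fan P')]])).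
      move=> i Ni; exists (P (s i) : set 'rV[R]_n); last by rewrite (sP i).2.
      by split=> //; exact: polytopeP.
    apply: finite_preimage; last exact: finite_coarsenings.
    by move=> i l _ _; apply: inj; rewrite inE.
  move/(finite_image (fun i => sh (s i))); apply: sub_finite_set.
  move=> _ [[i _ <-] [Q _ QE]]; exists i => //=.
  move: QE => /shape_of_eq/normal_fan_homothety E.
  by have := set_valP Q; rewrite /fan_polytopes /= E.
have [j pj] : exists j, ~ X j (sh p).
  have [[i ip]|np] := pselect (exists i, sh (s i) = sh p).
    exists i.+1 => -[l /= il]; rewrite -ip => /sh_inj li.
    by rewrite li ltnn in il.
  by exists 0%N => -[l _ lp]; apply: np; exists l.
have shp : sh y @[y --> within K (nbhs p)] --> sh p.
  apply: (@cvg_comp _ _ _ P (@shape_of R n) _ _ _ (cP p Kp)).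
  move=> V hV; have /= h := @initial_continuous _ _ (@cw_chart R n) (P p).
  have : nbhs (cw_chart (P p)) (fst @^-1` V) by exact: cvg_fst.
  exact: h.
have near_p : \forall y \near p, K y -> ~ X j (sh y).
  have : nbhs (sh p) (~` X j) by apply: open_nbhs_nbhs; split=> //; exact: closed_openC.
  by move=> /shp.
have [|_ [[i ji <-] /(_ (sP i).1)]] := sp [set s i | i in [set i | (j <= i)%N]] _ _ near_p.
  by exists j => // i /= ji; exists i.
by apply; exists i.
Qed.

(** It suffices to resolve one polytope for each of the finitely many fans. *)
Lemma finite_fans_compatible (A : set (set 'rV[R]_n)) :
  (forall P, A P -> is_delzant P) -> finite_set [set normal_fan P | P in A] ->
  exists (K : finType) (Q : set 'rV[R]_n) (w : K -> 'rV[R]_n) (B : K -> 'M[int]_n),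
    smooth_model Q w B /\ forall P, A P -> forall k, compatible P (B k).
Proof.
move=> dA /finite_seqP[s sE].
have /choice[g gP] : forall N : set (set 'cV[R]_n), exists us : seq 'rV[int]_n,
    N \in s -> exists P, [/\ A P, normal_fan P = N & forall M, M \in unitmx ->
      (forall u, u \in us -> same_sign M u) -> compatible P M].
  move=> N; have [Ns|nNs] := pselect (N \in s); last by exists [::].
  have [P AP PN] : [set normal_fan P | P in A] N by rewrite sE.
  have [us usP] := delzant_compatible (dA P AP).
  by exists us => _; exists P.
have [K [Q [w [B [mQ usB]]]]] := @common_resolution R n (flatten [seq g N | N <- s]).
exists K, Q, w, B; split=> // P AP.
have Ns : normal_fan P \in s by have : [set` s] (normal_fan P) by rewrite -sE; exists P.
have [P' [AP' P'E P'c]] := gP _ Ns.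
apply: (refines_compatible mQ); rewrite -P'E; apply: (model_refines mQ).
  by case: (dA P' AP').
move=> k; apply: P'c; first exact: smooth_unit (model_vertex mQ k).
by move=> u ug; apply: usB; apply/flatten_mapP; exists (normal_fan P).
Qed.

End CompactFamilies.

Section Blending.
Context {R : realType} {n : nat}.
Implicit Types (P Q S : set 'rV[R]_n) (a b c : R).

(** The Minkowski combination [a P + b Q + c S]. *)
Definition blend a b c P Q S : set 'rV[R]_n :=
  [set z | exists x y w, [/\ P x, Q y, S w & z = a *: x + b *: y + c *: w]].

Lemma convex_blend a b c P Q S : convex_set P -> convex_set Q -> convex_set S ->
  convex_set (blend a b c P Q S).
Proof.
move=> cP cQ cS _ _ t [x [y [w [Px Qy Sw ->]]]] [x' [y' [w' [Px' Qy' Sw' ->]]]] t01.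
exists (t *: x + (1 - t) *: x'), (t *: y + (1 - t) *: y'), (t *: w + (1 - t) *: w').
split; [exact: cP|exact: cQ|exact: cS|].
by apply/rowP => i; rewrite !mxE; ring.
Qed.

Lemma support_fun_blend a b c P Q S (v : 'cV[R]_n) : 0 <= a -> 0 <= b -> 0 <= c ->
  is_polytope P -> is_polytope Q -> is_polytope S ->
  support_fun (blend a b c P Q S) v =
  a * support_fun P v + b * support_fun Q v + c * support_fun S v.
Proof.
move=> a0 b0 c0 pP pQ pS.
have [x [Px -> xm]] := support_fun_max v pP.
have [y [Qy -> ym]] := support_fun_max v pQ.
have [w [Sw -> wm]] := support_fun_max v pS.
rewrite (@support_funE _ _ _ _ (a *: x + b *: y + c *: w)).
- by rewrite !pairingDr !pairingZr.
- by exists x, y, w.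
- move=> _ [x' [y' [w' [Px' Qy' Sw' ->]]]]; rewrite !pairingDr !pairingZr.
  by rewrite !lerD// ler_wpM2l// ?xm ?ym ?wm.
Qed.

Lemma in_cone_blend a b c (M : 'M[int]_n) x y w x0 y0 w0 : 0 <= a -> 0 <= b -> 0 <= c ->
  in_cone M (x - x0 : 'rV[R]_n) -> in_cone M (y - y0) -> in_cone M (w - w0) ->
  in_cone M (a *: x + b *: y + c *: w - (a *: x0 + b *: y0 + c *: w0)).
Proof.
move=> a0 b0 c0 hx hy hw; have [_ cD cZ] := @convex_cone_in_cone R n M.
have -> : a *: x + b *: y + c *: w - (a *: x0 + b *: y0 + c *: w0) =
  a *: (x - x0) + b *: (y - y0) + c *: (w - w0).
  by apply/rowP => i; rewrite !mxE; ring.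
by apply: (cD); [apply: (cD)|]; exact: (cZ).
Qed.

Lemma compatible_blend a b c P Q S M : 0 <= a -> 0 <= b -> 0 <= c ->
  compatible P M -> compatible Q M -> compatible S M ->
  compatible (blend a b c P Q S) M.
Proof.
move=> a0 b0 c0 [x0 Px0 xP] [y0 Qy0 yQ] [w0 Sw0 wS].
exists (a *: x0 + b *: y0 + c *: w0); first by exists x0, y0, w0.
move=> _ [x [y [w [Px Qy Sw ->]]]].
by apply: in_cone_blend; [| | |exact: xP|exact: yQ|exact: wS].
Qed.

Lemma model_compatible (K : finType) Q w B : @smooth_model R n K Q w B ->
  forall k, compatible Q (B k).
Proof. by move=> mQ k; have [Qw _ cQ _] := model_vertex mQ k; exists (w k). Qed.

(** A positive multiple of a smooth polytope [S] imposes its unimodular cones on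
    the sum, because the cones of the other summands at the corresponding
    points are contained in them. *)
Lemma blend_delzant (K : finType) S w B a b c P Q : @smooth_model R n K S w B ->
  is_polytope P -> is_polytope Q ->
  (forall k, compatible P (B k)) -> (forall k, compatible Q (B k)) ->
  0 <= a -> 0 <= b -> 0 < c -> is_delzant (blend a b c P Q S).
Proof.
move=> mS pP pQ cP cQ a0 b0 c0.
have /choice[w' wP] k : exists w', smooth_vertex (blend a b c P Q S) w' (B k).
  have [x0 Px0 xP] := cP k; have [y0 Qy0 yQ] := cQ k.
  have [Sw uB wS [d d0 Sd]] := model_vertex mS k.
  exists (a *: x0 + b *: y0 + c *: w k); split=> //.
  - by exists x0, y0, (w k).
  - move=> _ [x [y [z [Px Qy Sz ->]]]].
    by apply: in_cone_blend => //; [exact: ltW|exact: xP|exact: yQ|exact: wS].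
  - exists (c * d) => [|i]; first exact: mulr_gt0.
    exists x0, y0, (w k + d *: edge_dir (B k) i); split=> //.
    by rewrite scalerDr scalerA addrA.
apply: (@model_delzant _ _ K _ w' B); split=> //; last exact: model_complete mS.
by apply: convex_blend; [exact: polytope_convex..|exact: model_convex mS].
Qed.

Lemma blend_left P Q S : Q !=set0 -> S !=set0 -> blend 1 0 0 P Q S = P.
Proof.
move=> [q Qq] [s Ss]; apply/seteqP; split=> [_ [x [y [w [Px _ _ ->]]]]|x Px].
  by rewrite scale1r !scale0r !addr0.
by exists x, q, s; rewrite scale1r !scale0r !addr0.
Qed.

Lemma blend_right P Q S : P !=set0 -> S !=set0 -> blend 0 1 0 P Q S = Q.
Proof.
move=> [q Qq] [s Ss]; apply/seteqP; split=> [_ [x [y [w [_ Qy _ ->]]]]|y Qy].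
  by rewrite scale1r !scale0r add0r addr0.
by exists q, y, s; rewrite scale1r !scale0r add0r addr0.
Qed.

Lemma blend_self (t : R) P S : 0 <= t <= 1 -> convex_set P -> S !=set0 ->
  blend (1 - t) t 0 P P S = P.
Proof.
move=> /andP[t0 t1] cP [s Ss]; apply/seteqP.
split=> [_ [x [y [w [Px Py _ ->]]]]|x Px].
  rewrite scale0r addr0 -{2}[t](subKr 1); apply: cP => //.
  by rewrite subr_ge0 t1 gerBl.
by exists x, x, s; rewrite scale0r addr0 -scalerDl subrK scale1r.
Qed.

End Blending.

Section DelzantSpace.
Context {R : realType} {n : nat}.

Lemma delzant_eq (D E : delzant R n) : (D : set 'rV[R]_n) = E -> D = E.
Proof.
case: D E => [D hD] [E hE] /= DE; subst E; congr Delzant; exact: Prop_irrelevance.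
Qed.

Context (n_gt0 : (0 < n)%N).

Lemma delzant_not_point (D : set 'rV[R]_n) : is_delzant D -> ~ is_point D.
Proof.
move=> [_ [_ [U [dU _ Umin]]] _ _ _] [x Dx].
have /dimvS : (U <= 0)%VS.
  by apply: Umin => y z; rewrite Dx => -> ->; rewrite subrr mem0v.
by rewrite dU dimv0 leqNgt n_gt0.
Qed.

Definition delzant_npolytope (D : delzant R n) : npolytope R n :=
  @NPolytope _ _ (@Polytope _ _ D (let: And5 pD _ _ _ _ := delzantP D in pD))
    (delzant_not_point (delzantP D)).

Lemma delzant_npolytope_unique (D : delzant R n) (P : npolytope R n) :
  (D : set 'rV[R]_n) = P -> P = delzant_npolytope D.
Proof.
move=> DP; case: P DP => [[P pP] nP] /= DP; move: pP nP; rewrite -{}DP => pP nP.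
rewrite /delzant_npolytope; have E : pP = (let: And5 pD _ _ _ _ := delzantP D in pD).
  exact: Prop_irrelevance.
by subst pP; congr NPolytope; exact: Prop_irrelevance.
Qed.

Lemma delzant_cvgP (T : Type) (F : set_system T) {FF : Filter F}
    (D : T -> delzant R n) (D0 : delzant R n) :
  D y @[y --> F] --> D0 <->
  delzant_npolytope (D y) @[y --> F] --> (delzant_npolytope D0 : npolytope_space R n).
Proof.
split=> cD V; rewrite nbhsE => -[U [Uo U0] UV].
  have : nbhs D0 (fun D => U (delzant_npolytope D)).
    apply: open_nbhs_nbhs; split=> //; exists U => // E P EP.
    by rewrite (delzant_npolytope_unique EP).
  move=> /cD h; suff : \forall y \near F, V (delzant_npolytope (D y)) by [].
  have {}h : \forall y \near F, U (delzant_npolytope (D y)) by exact: h.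
  by apply: filterS h => y; exact: UV.
have [W Wo WP] := Uo.
have : nbhs (delzant_npolytope D0 : npolytope_space R n) W.
  by apply: open_nbhs_nbhs; split=> //; exact/(WP D0).
move=> /cD h; suff : \forall y \near F, V (D y) by [].
have {}h : \forall y \near F, W (delzant_npolytope (D y)) by exact: h.
by apply: filterS h => y Wy; apply: UV; exact/(WP (D y) (delzant_npolytope (D y)) erefl).
Qed.

End DelzantSpace.

Section WeakContraction.
Context {R : realType} {n : nat}.

Lemma cvg_prodr (T I : Type) (F : set_system T) {FF : Filter F} (s : seq I)
    (f : I -> T -> R) (l : I -> R) : (forall i, f i z @[z --> F] --> l i) ->
  (\prod_(i <- s) f i z) @[z --> F] --> \prod_(i <- s) l i.
Proof.
move=> fl; elim: s => [|i s IH].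
  by under eq_fun do rewrite big_nil; rewrite big_nil; exact: cvg_cst.
under eq_fun do rewrite big_cons; rewrite big_cons.
by apply: cvgM; [exact: fl|exact: IH].
Qed.

Lemma compact_cube k : compact (@cube R k).
Proof.
have -> : @cube R k = [set s | forall i, `[0, 1]%classic (s 0 i)].
  by apply/seteqP; split=> s sP i; have := sP i; rewrite /= in_itv.
by apply: (@rV_compact R k (fun=> `[0, 1]%classic)) => i; exact: segment_compact.
Qed.

Lemma finite_delzant_fans k (f : 'rV[R]_k -> delzant R n) : (0 < n)%N ->
  {within @cube R k, continuous f} ->
  finite_set [set normal_fan (f s : set 'rV[R]_n) | s in @cube R k].
Proof.
move=> n0 /subspace_continuousP cf.
apply: (@finite_normal_fans R n 'rV[R]_k (@cube R k) (fun s => delzant_npolytope n0 (f s))).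
  exact: compact_cube.
by move=> s ks; apply/delzant_cvgP; exact: cf.
Qed.

(** The homotopy [(1 - t) f + t g + lam Q], where the smooth polytope [Q] has a
    normal fan refining those of all the values of [f] and [g]. *)
Lemma delzant_trivial_pi k (x0 : delzant R n) : (0 < n)%N -> trivial_pi R k x0.
Proof.
move=> n0 f g [cf f0] [cg g0].
have pD (D : delzant R n) : is_polytope (D : set 'rV[R]_n) by case: (delzantP D).
pose A := [set (f s : set 'rV[R]_n) | s in @cube R k] `|` [set (g s : set 'rV[R]_n) | s in @cube R k].
have [||K [Q [w [B [mQ cA]]]]] := @finite_fans_compatible R n A.
- by move=> _ [[s _ <-]|[s _ <-]]; exact: delzantP.
- apply: (@sub_finite_set _ _ ([set normal_fan (f s : set 'rV[R]_n) | s in @cube R k] `|`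
    [set normal_fan (g s : set 'rV[R]_n) | s in @cube R k])).
    by move=> _ [_ [[s ks <-]|[s ks <-]] <-]; [left|right]; exists s.
  by rewrite finite_setU; split; exact: finite_delzant_fans.
have cf_ s : cube s -> forall j, compatible (f s : set 'rV[R]_n) (B j).
  by move=> ks; apply: cA; left; exists s.
have cg_ s : cube s -> forall j, compatible (g s : set 'rV[R]_n) (B j).
  by move=> ks; apply: cA; right; exists s.
have pQ := model_polytope mQ; have Q0 := polytope_nonempty pQ.
have D0 (D : delzant R n) := polytope_nonempty (pD D).
(* [lam] vanishes exactly on the boundary of the prism, where the homotopy is
   prescribed *)
pose lam (y : R * 'rV[R]_k) : R := y.1 * (1 - y.1) * \prod_i (y.2 0 i * (1 - y.2 0 i)).
pose H' (y : R * 'rV[R]_k) := blend (1 - y.1) y.1 (lam y)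
  (f y.2 : set 'rV[R]_n) (g y.2 : set 'rV[R]_n) Q.
pose D := (`[0, 1]%classic `*` @cube R k) : set (R * 'rV[R]_k).
have lam_ge0 y : D y -> 0 <= lam y.
  move=> [/= + ky]; rewrite in_itv /= => /andP[y0 y1].
  rewrite /lam mulr_ge0 ?mulr_ge0 ?subr_ge0//; apply: prodr_ge0 => i _.
  by have /andP[? ?] := ky i; rewrite mulr_ge0 ?subr_ge0.
have H'0 s : cube s -> H' (0, s) = f s.
  move=> ks; rewrite /H' /lam /= subr0 !mul0r; exact: blend_left (D0 _) Q0.
have H'1 s : cube s -> H' (1, s) = g s.
  move=> ks; rewrite /H' /lam /= subrr mulr0 mul0r; exact: blend_right (D0 _) Q0.
have H'b t s : 0 <= t <= 1 -> cube_boundary s -> H' (t, s) = x0.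
  move=> t01 bs; rewrite /H' /lam /= f0// g0//.
  have [_ [i si]] := bs; rewrite (bigD1 i)//=.
  have -> : s 0 i * (1 - s 0 i) = 0 by case: si => ->; rewrite ?mul0r ?subrr ?mulr0.
  by rewrite mul0r mulr0; apply: blend_self => //; exact: polytope_convex.
have H'D y : D y -> is_delzant (H' y).
  move=> Dy; have [/= + ky] := Dy; rewrite in_itv /= => y01; have /andP[y0 y1] := y01.
  have [lam0|lam0] := eqVneq (lam y) 0; last first.
    apply: (blend_delzant mQ); rewrite ?subr_ge0//; [exact: cf_|exact: cg_|].
    by rewrite lt_neqAle eq_sym lam0 lam_ge0.
  move/eqP: lam0; rewrite /lam !mulf_eq0 subr_eq0 => /orP[/orP[]|].
  - move=> /eqP y10; have -> : y = (0, y.2) by rewrite -y10 -surjective_pairing.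
    by rewrite H'0//; exact: delzantP.
  - move=> /eqP y11; have -> : y = (1, y.2) by rewrite y11 -surjective_pairing.
    by rewrite H'1//; exact: delzantP.
  - move=> /prodf_eq0[i _]; rewrite /= mulf_eq0 subr_eq0 => yi.
    rewrite [y]surjective_pairing H'b//; first exact: delzantP.
    split=> //; exists i; by case/orP: yi => /eqP h; [left|right].
pose H (y : R * 'rV[R]_k) : delzant R n :=
  if pselect (is_delzant (H' y)) is left h then Delzant h else x0.
have HE y : D y -> (H y : set 'rV[R]_n) = H' y.
  by move=> /H'D h; rewrite /H; case: pselect.
have D_0 s : cube s -> D (0, s).
  by move=> ks; split=> //; rewrite /= in_itv /= lexx ler01.
have D_1 s : cube s -> D (1, s) by move=> ks; split=> //; rewrite /= in_itv /= lexx ler01.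
exists H; split.
- apply/subspace_continuousP => y Dy.
  set F := within _ _.
  have FF : Filter F by exact: within_filter.
  have FD : \forall z \near F, D z by exact: withinT.
  have supp z b : D z -> support_fun (H z : set 'rV[R]_n) b =
      (1 - z.1) * support_fun (f z.2 : set 'rV[R]_n) b +
      z.1 * support_fun (g z.2 : set 'rV[R]_n) b + lam z * support_fun Q b.
    move=> Dz; have [/= + _] := Dz; rewrite in_itv /= => /andP[z0 z1].
    by rewrite HE// support_fun_blend// ?subr_ge0// lam_ge0.
  have compat z : D z -> refines (normal_fan Q) (normal_fan (H z : set 'rV[R]_n)).
    move=> Dz; have [/= + kz] := Dz; rewrite in_itv /= => /andP[z0 z1].
    apply: (model_refines mQ) => // j; rewrite HE//.
    by apply: compatible_blend; rewrite ?subr_ge0 ?lam_ge0//; [exact: cf_|exact: cg_|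
       exact: model_compatible mQ j].
  have Fy : F --> y by exact: cvg_within.
  have c1 : z.1 @[z --> F] --> y.1.
    by apply: (@cvg_comp _ _ _ id fst _ _ _ Fy); exact: cvg_fst.
  have c2 : z.2 @[z --> F] --> y.2.
    by apply: (@cvg_comp _ _ _ id snd _ _ _ Fy); exact: cvg_snd.
  have c2' : z.2 @[z --> F] --> within (@cube R k) (nbhs y.2).
    move=> V kV; suff : \forall z \near F, V z.2 by [].
    have : \forall z \near F, cube z.2 -> V z.2 by exact: (c2 _ kV).
    by apply: filterS2 FD => z [_ kz]; apply.
  have supp_cvg (h : 'rV[R]_k -> delzant R n) b : {within @cube R k, continuous h} ->
      support_fun (h z.2 : set 'rV[R]_n) b @[z --> F] --> support_fun (h y.2 : set 'rV[R]_n) b.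
    move=> /subspace_continuousP/(_ y.2 Dy.2) ch.
    apply: (@support_fun_cvg R n b _ F FF (fun z => delzant_npolytope n0 (h z.2))
       (delzant_npolytope n0 (h y.2))).
    apply/delzant_cvgP.
    exact: (@cvg_comp _ _ _ (fun z : R * 'rV[R]_k => z.2) h _ _ _ c2' ch).
  have lam_cvg : lam z @[z --> F] --> lam y.
    apply: cvgM; first by apply: cvgM => //; apply: cvgB => //; exact: cvg_cst.
    apply: cvg_prodr => i.
    have ci : (z : R * 'rV[R]_k).2 0 i @[z --> F] --> y.2 0 i.
      apply: (@cvg_comp _ _ _ (fun z : R * 'rV[R]_k => z.2) (fun s : 'rV[R]_k => s 0 i) _ _ _ c2).
      exact: coord_continuous.
    by apply: cvgM => //; apply: cvgB => //; exact: cvg_cst.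
  apply/(delzant_cvgP n0).
  apply: (@npolytope_cvg R n (normal_fan Q)) => [|| |b]; first by exists Q.
  + by apply: filterS FD => z; exact: compat.
  + exact: compat.
  + have bc : ((1 - z.1) * support_fun (f z.2 : set 'rV[R]_n) b +
        z.1 * support_fun (g z.2 : set 'rV[R]_n) b + lam z * support_fun Q b) @[z --> F] -->
      (1 - y.1) * support_fun (f y.2 : set 'rV[R]_n) b +
      y.1 * support_fun (g y.2 : set 'rV[R]_n) b + lam y * support_fun Q b.
      apply: cvgD; last by apply: cvgM => //; exact: cvg_cst.
      apply: cvgD; last by apply: cvgM => //; exact: supp_cvg.
      by apply: cvgM; [apply: cvgB => //; exact: cvg_cst|exact: supp_cvg].
    rewrite /= supp//; apply: cvg_trans bc.
    by apply: near_eq_cvg; apply: filterS FD => z Dz; rewrite /= supp.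
- by move=> s ks; apply: delzant_eq; rewrite HE ?H'0//; exact: D_0.
- by move=> s ks; apply: delzant_eq; rewrite HE ?H'1//; exact: D_1.
- move=> t s t01 bs; apply: delzant_eq; rewrite HE ?H'b//.
  by split; [rewrite /= in_itv|case: bs].
Qed.

End WeakContraction.

Theorem corollary3p51 (R : realType) (n : nat) :
  weakly_contractible R (delzant R n).
Proof.
split=> [|k x0].
  have [K [Q [w [B mQ]]]] := @cube_model R n.
  by exists (Delzant (model_delzant mQ)).
(* in dimension zero there is a single Delzant polytope *)
have [n0|n0] := posnP n; last exact: delzant_trivial_pi.
subst n; have one (D : delzant R 0) : D = x0.
  apply: delzant_eq.
  have full (E : delzant R 0) : (E : set 'rV[R]_0) = setT.
    have [/polytope_nonempty[x Ex] _ _ _ _] := delzantP E.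
    by apply/seteqP; split=> // y _; rewrite (_ : y = x)//; apply/rowP => -[].
  by rewrite !full.
move=> f g _ _; exists (fun=> x0); split=> //.
- by apply: continuous_subspaceT => y; exact: cvg_cst.
Qed.
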